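(* Let $\mathbb I:so(n)\to so(n)$ be symmetric positive definite, $D>0$, $\mathbf I=\mathbb I+D\mathbb E$, $\epsilon=\sigma/(\sigma\pm\rho)$. (i) The extended system of the rubber rolling of a ball over a fixed sphere, $$\dot{\mathbf m}=\epsilon[\mathbf m,\omega]+(1-\epsilon)\,\mathrm{pr}_{\mathfrak v_\gamma}[\mathbf I\omega,\omega],\qquad \dot\gamma=-\epsilon\,\omega\gamma,$$ on $so(n)^*\times S^{n-1}$ in the variables $(\mathbf m,\gamma)$, where $\mathbf m=\mathrm{pr}_{\mathfrak v_\gamma}\mathbf I\omega+\mathrm{pr}_{\mathfrak h_\gamma}\omega$, has the invariant measure $\tilde\mu_\epsilon\,\mathrm d\mathbf m\wedge\mathrm d\gamma$, where $$\tilde\mu_\epsilon(\gamma)=\big(\det\mathbf I|_{\mathfrak v_\gamma}\big)^{\frac1{2\epsilon}-1}.$$ (ii) For $\mathbb I$ defined by $\mathbb I(E_i\wedge E_j)=(a_ia_j-D)E_i\wedge E_j$, i.e. $\mathbf I(E_i\wedge E_j)=a_ia_j\,E_i\wedge E_j$ ($1\le i<j\le n$, $a_i>0$), the density $\tilde\mu_\epsilon(\gamma)$ is proportional (with a factor independent of $\gamma$) to $$(\gamma,A\gamma)^{\left(\frac1{2\epsilon}-1\right)(n-2)},\qquad A=\mathrm{diag}(a_1,\dots,a_n).$$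
   Context: Vectors of $\mathbb R^n$ are columns, $(x,y)=x^Ty$, $x\otimes y=xy^T$, $x\wedge y=xy^T-yx^T$; $E_1,\dots,E_n$ is the standard basis of $\mathbb R^n$. Identify $so(n)\cong so(n)^*$ by $\langle X,Y\rangle=-\frac12\mathrm{tr}(XY)$; $\mathbb E$ is the identity operator on $so(n)$. For $\gamma\in S^{n-1}$, $\mathfrak v_\gamma=\mathbb R^n\wedge\gamma\subset so(n)$, $\mathfrak h_\gamma=\mathfrak v_\gamma^\perp$; orthogonal projections $\mathrm{pr}_{\mathfrak v_\gamma}\xi=\xi\,\gamma\otimes\gamma+\gamma\otimes\gamma\,\xi$, $\mathrm{pr}_{\mathfrak h_\gamma}=\mathbb E-\mathrm{pr}_{\mathfrak v_\gamma}$. $\det\mathbf I|_{\mathfrak v_\gamma}$ is the determinant of the restriction of the quadratic form of $\mathbf I$ to $\mathfrak v_\gamma$, i.e. of the operator $\mathrm{pr}_{\mathfrak v_\gamma}\circ\mathbf I|_{\mathfrak v_\gamma}:\mathfrak v_\gamma\to\mathfrak v_\gamma$. For each $\gamma$ the linear map $\omega\mapsto\mathbf m$ is invertible, so the equations define a closed system in $(\mathbf m,\gamma)$. The constants come from a ball of radius $\rho>0$ and mass $m_b$ ($D=m_b\rho^2$) rolling without slipping and twisting over a fixed sphere of radius $\sigma>0$: sign $+$ for rolling over the outer surface; sign $-$ for rolling over the inner surface ($\sigma>\rho$) or for a spherical shell rolling around a fixed sphere in its interior ($\sigma<\rho$). So $\epsilon$ is a nonzero real constant. $\mathrm d\mathbf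 m$, $\mathrm d\gamma$ are the standard volume forms on $so(n)^*$ and $S^{n-1}$. ''Has an invariant measure'' given by a volume form means that the flow preserves that volume form. *)

(* Defs.v *)
From HB Require Import structures.
From mathcomp Require Import all_boot all_order all_algebra.
From mathcomp Require Import all_classical all_reals all_analysis.

Set Implicit Arguments.
Unset Strict Implicit.
Unset Printing Implicit Defensive.

Import Order.TTheory GRing.Theory Num.Theory.
Import numFieldNormedType.Exports.

Local Open Scope classical_set_scope.
Local Open Scope ring_scope.

Section LinearAlgebra.
Context {R : realType} {n : nat}.
Implicit Types (x y g : 'cV[R]_n) (X Y xi : 'M[R]_n).

Definition dotv x y : R := (x^T *m y) 0 0.
Definition tensor x y : 'M[R]_n := x *m y^T.
Definition wedge x y : 'M[R]_n := x *m y^T - y *m x^T.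
Definition basis_vec (i : 'I_n) : 'cV[R]_n := delta_mx i 0.

Definition sphere : set 'cV[R]_n := [set g | dotv g g = 1].
Definition so : set 'M[R]_n := [set X | X^T = - X].

(* so(n) and its dual are identified through this scalar product. *)
Definition so_dot X Y : R := - 2^-1 * \tr (X *m Y).
Definition lie_bracket X Y : 'M[R]_n := X *m Y - Y *m X.

(* R^n /\ g, as the image of the linear map x |-> x /\ g. *)
Definition v_space g : {vspace 'M[R]_n} :=
  limg (linfun (fun x : 'cV[R]_n => wedge x g)).
Definition pr_v g xi : 'M[R]_n := xi *m tensor g g + tensor g g *m xi.
Definition pr_h g xi : 'M[R]_n := xi - pr_v g xi.

End LinearAlgebra.

Arguments so {R} n.
Arguments sphere {R} n.

(* Operators on so(n) are represented by linear maps on all n x n matrices that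
   preserve so(n); only their restriction to so(n) is ever used. *)
Definition sym_posdef_on_so {R : realType} {n : nat}
    (T : {linear 'M[R]_n -> 'M[R]_n}) : Prop :=
  [/\ forall X, so n X -> so n (T X),
      forall X Y, so n X -> so n Y -> so_dot (T X) Y = so_dot X (T Y)
    & forall X, so n X -> X != 0 -> 0 < so_dot (T X) X].

(* The determinant of the endomorphism of U induced by f (for f linear and
   mapping U into itself), computed in a basis of U. *)
Definition det_on {R : fieldType} {vT : vectType R} (U : {vspace vT})
    (f : vT -> vT) : R :=
  \det (\matrix_(i < \dim U, j < \dim U)
          coord (vbasis U) j (f (vbasis U)`_i)).

(* M is a subset of the normed space V, and F x v means that v is the value at
   x of the (possibly implicitly defined) vector field F.  The flow domain is
   the trace of the open set U on R x M; no regularity of phi with respect to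
   the initial condition is required. *)
Definition is_local_flow {R : realType} {V : normedModType R} (M : set V)
    (F : V -> V -> Prop) (U : set (R * V)) (phi : R -> V -> V) : Prop :=
  [/\ open U,
      forall (x : V) (s t : R), M x -> U (t, x) ->
        (0 <= s <= t) || (t <= s <= 0) -> U (s, x),
      forall x : V, M x -> U (0, x) -> phi 0 x = x
    & forall (x : V) (t : R), M x -> U (t, x) ->
        M (phi t x) /\
        exists2 v : V, F (phi t x) v & is_derive t (1 : R) (phi^~ x) v].

(* f^* Om = Om at x, where Om is a form of degree N on M.  Tangent vectors are
   the velocities of curves in M, and the differential of f sends the velocity
   of c to the velocity of f \o c, whose existence is part of the claim. *)
Definition preserves_form_at {R : realType} {V : normedModType R} {N : nat}
    (M : set V) (Om : V -> ('I_N -> V) -> R) (f : V -> V) (x : V) : Prop :=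
  forall (c : 'I_N -> R -> V) (u : 'I_N -> V),
    (forall k, [/\ c k 0 = x, \forall s \near (0 : R), M (c k s)
                 & is_derive (0 : R) (1 : R) (c k) (u k)]) ->
  exists2 w : 'I_N -> V,
    forall k, is_derive (0 : R) (1 : R) (f \o c k) (w k)
    & Om (f x) w = Om x u.

Definition flow_preserves_form {R : realType} {V : normedModType R} {N : nat}
    (M : set V) (F : V -> V -> Prop) (Om : V -> ('I_N -> V) -> R) : Prop :=
  forall (U : set (R * V)) (phi : R -> V -> V), is_local_flow M F U phi ->
  forall (x : V) (t : R), M x -> U (t, x) -> preserves_form_at M Om (phi t) x.

(* From here on the ambient dimension is n.+1: the algebra is so(n.+1) and the
   sphere has dimension n. *)
Section RubberRolling.
Context {R : realType} {n : nat}.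

Definition phase : normedModType R := ('M[R]_n.+1 * 'cV[R]_n.+1)%type.

Definition phase_space : set phase :=
  [set x | so n.+1 x.1 /\ sphere n.+1 x.2].

Definition upper_pairs : {set 'I_n.+1 * 'I_n.+1} :=
  [set p : 'I_n.+1 * 'I_n.+1 | (p.1 < p.2)%N].

(* Coordinates in the basis E_i /\ E_j, i < j, orthonormal for so_dot. *)
Definition so_coords (X : 'M[R]_n.+1) : 'rV[R]_#|upper_pairs| :=
  \row_k X (enum_val k).1 (enum_val k).2.

Definition phase_coords (x : phase) : 'rV[R]_(n.+1 + #|upper_pairs|) :=
  row_mx x.2^T (so_coords x.1).

(* The form dm /\ dg.  The volume form dg of the sphere is the contraction of
   the volume form of R^n.+1 with the outward normal g, so the determinant
   below is dg /\ dm, and the sign reorders the two factors. *)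
Definition dm_dgamma (x : phase) (u : 'I_(n + #|upper_pairs|) -> phase) : R :=
  (-1) ^+ (#|upper_pairs| * n) *
  \det (col_mx (phase_coords (0, x.2)) (\matrix_k phase_coords (u k))
        : 'M[R]_(n.+1 + #|upper_pairs|)).

Variables (II : {linear 'M[R]_n.+1 -> 'M[R]_n.+1}) (D eps : R).

Definition total_inertia (xi : 'M[R]_n.+1) : 'M[R]_n.+1 := II xi + D *: xi.

(* The angular velocity omega is the unique solution in so(n.+1) of the first
   equation, m = pr_v (I omega) + pr_h omega. *)
Definition rubber_rolling (x v : phase) : Prop :=
  exists omega : 'M[R]_n.+1,
    [/\ so n.+1 omega,
        x.1 = pr_v x.2 (total_inertia omega) + pr_h x.2 omega,
        v.1 = eps *: lie_bracket x.1 omega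
            + (1 - eps) *: pr_v x.2 (lie_bracket (total_inertia omega) omega)
      & v.2 = - (eps *: (omega *m x.2))].

Definition density (g : 'cV[R]_n.+1) : R :=
  det_on (v_space g) (pr_v g \o total_inertia) `^ ((2 * eps)^-1 - 1).

Definition invariant_form (x : phase) (u : 'I_(n + #|upper_pairs|) -> phase)
  : R := density x.2 * dm_dgamma x u.

End RubberRolling.

(* Main.v *)
(** In an orthonormal basis of so(n) the first equation reads m = w B(g) with
B(g) = 1 + (I - 1) P(g), where P(g) is the matrix of the projection onto v_g.  Since
P(g) is conjugated by a rotation of g, Jacobi's formula gives along a solution
(log det B)' = 2 eps tr (B^-1 ad_w), while the divergence of the vector field is
- (1 - 2 eps) tr (B^-1 ad_w) because most terms are traces of products of a symmetric
and a skew matrix.  Hence (det B)^(1/(2 eps) - 1) times the volume is preserved, and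
by Sylvester's identity det B = det I|v_g.

The flow is not assumed to depend smoothly on the initial condition.  The difference
quotients of the flow satisfy the linearized equation up to O(h), so they are Cauchy
as h tends to 0, and the derivative of their weighted determinant is O(h).  The sphere
is handled by adding the vector (g, 0) as first row: extending P homogeneously of
degree 0 off the sphere, this row also solves the linearized equation.

For the diagonal inertia, a second use of Sylvester's identity reduces det B to a
2 x 2 determinant. *)

Require Import Defs.
From HB Require Import structures.
From mathcomp Require Import all_boot all_order all_algebra.
From mathcomp Require Import all_classical all_reals all_analysis.
From mathcomp Require Import perm ring lra.
Set Implicit Arguments.
Unset Strict Implicit.
Unset Printing Implicit Defensive.
Import Order.TTheory GRing.Theory Num.Theory.
Import numFieldNormedType.Exports.
Local Open Scope classical_set_scope.
Local Open Scope ring_scope.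

(** * Trace identities for the resolvent *)

(** All vanishing traces rest on one identity: P B = B^T P, so P B^-1 is symmetric and its product
    with any [ad_mx] is traceless. A field on the sphere has no ambient derivative, so [jacobian] is
    prescribed by a formula and justified only by a remainder bound between points of the phase
    space. If g and g + u are both unit vectors, the radial part of u is -|u|^2/2, of second order;
    to first order only the rotation by u /\ g is seen, and the radial derivative may be prescribed
    at will. The remainder bound is uniform in the second point, however far away: the sphere is
    bounded, coercivity bounds B^-1 uniformly in g, and the field is quadratic in m. This is what
    lets neighbouring solutions be compared without knowing beforehand that they stay close. *)

Section TraceIdentities.
Variables (R : realFieldType) (k : nat).
Implicit Types S A C P Q : 'M[R]_k.

Lemma mxtraceN m (A : 'M[R]_m) : \tr (- A) = - \tr A.
Proof. exact: raddfN. Qed.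

Lemma mxtraceB m (S A : 'M[R]_m) : \tr (S - A) = \tr S - \tr A.
Proof. exact: raddfB. Qed.

Lemma mxtrace_sym_skew m (S A : 'M[R]_m) : S^T = S -> A^T = - A -> \tr (S *m A) = 0.
Proof.
move=> hS hA; have := mxtrace_tr (S *m A).
rewrite trmx_mul hS hA mulNmx mxtraceN mxtrace_mulC; lra.
Qed.

Lemma mxtrace_skew m (A : 'M[R]_m) : A^T = - A -> \tr A = 0.
Proof. by move=> hA; rewrite -[A]mul1mx mxtrace_sym_skew // trmx1. Qed.

Lemma mxtrace_tr_skew C A : A^T = - A -> \tr (C^T *m A) = - \tr (C *m A).
Proof.
by move=> hA; rewrite -mxtrace_tr trmx_mul trmxK hA mulNmx mxtraceN mxtrace_mulC.
Qed.

Variables (P Q C : 'M[R]_k).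
Hypotheses (Psym : P^T = P) (PP : P *m P = P) (Qsym : Q^T = Q).
Hypothesis BC : (1%:M + Q *m P) *m C = 1%:M.

Let CB : C *m (1%:M + Q *m P) = 1%:M.
Proof. exact: mulmx1C. Qed.

Lemma resolvent_QPC : Q *m P *m C = 1%:M - C.
Proof. by rewrite -BC mulmxDl mul1mx addrAC subrr add0r. Qed.

Lemma resolvent_CQP : C *m (Q *m P) = 1%:M - C.
Proof. by rewrite -CB mulmxDr mulmx1 addrAC subrr add0r. Qed.

(** Idempotence gives P (1 - P) = 0, so B (1 - P) = 1 - P, and C cancels B. *)
Lemma resolvent_C1P : C *m (1%:M - P) = 1%:M - P.
Proof.
have B1P : (1%:M + Q *m P) *m (1%:M - P) = 1%:M - P.
  by rewrite mulmxDl mul1mx -mulmxA [P *m _]mulmxBr mulmx1 PP subrr mulmx0 addr0.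
by rewrite -[in LHS]B1P mulmxA CB mul1mx.
Qed.

Lemma resolvent_CP : C *m P = C - 1%:M + P.
Proof.
have -> : C *m P = C - C *m (1%:M - P) by rewrite mulmxBr mulmx1 opprB addrC subrK.
by rewrite resolvent_C1P opprB addrA addrAC.
Qed.

(** The source is P (1 + Q P) = (1 + P Q) P, multiplied by C^T on the left and by C on the right. *)
Lemma resolvent_trPC : C^T *m P = P *m C.
Proof.
have hCB : C^T *m (1%:M + P *m Q) = 1%:M.
  by rewrite -[P]Psym -[Q]Qsym -trmx_mul -[1%:M]trmx1 -linearD -trmx_mul BC.
have PB : P *m (1%:M + Q *m P) = (1%:M + P *m Q) *m P.
  by rewrite mulmxDr mulmxDl mulmx1 mul1mx mulmxA.
by rewrite -[LHS]mulmx1 -[in LHS]BC mulmxA -[_ *m P *m _]mulmxA PB !mulmxA hCB mul1mx.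
Qed.

Lemma resolvent_PC_sym : (P *m C)^T = P *m C.
Proof. by rewrite trmx_mul Psym resolvent_trPC. Qed.

Lemma resolvent_PCQ : P *m C *m Q = 1%:M - C^T.
Proof.
have <- : (Q *m P *m C)^T = 1%:M - C^T by rewrite resolvent_QPC linearB /= trmx1.
by rewrite -[in RHS]mulmxA trmx_mul resolvent_PC_sym Qsym.
Qed.

(* Logarithmic derivative of det (1 + Q P) when P varies with velocity
   [P, S], as it does along a rotation. *)
Lemma mxtrace_dlogdet S : S^T = - S ->
  \tr (C *m (Q *m (P *m S - S *m P))) = - \tr (C *m S) *+ 2.
Proof.
move=> hS; rewrite !mulmxBr mxtraceB.
have -> : C *m (Q *m (P *m S)) = S - C *m S.
  by rewrite mulmxA [_ *m (P *m S)]mulmxA -[C *m Q *m P]mulmxA resolvent_CQP mulmxBl mul1mx.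
have -> : \tr (C *m (Q *m (S *m P))) = \tr (C *m S).
  rewrite !mulmxA mxtrace_mulC !mulmxA resolvent_PCQ mulmxBl mul1mx mxtraceB.
  by rewrite mxtrace_tr_skew // mxtrace_skew // sub0r opprK.
by rewrite mxtraceB mxtrace_skew // sub0r mulr2n.
Qed.

Variables (n : nat) (W : 'M[R]_(n, k)) (Om : 'M[R]_n).
Hypothesis WW : W^T *m W = P.
Hypothesis Om_skew : Om^T = - Om.
Variables Aw Am AI Aq : 'M[R]_k.
Hypotheses (hw : Aw^T = - Aw) (hm : Am^T = - Am) (hI : AI^T = - AI)
  (hq : Aq^T = - Aq).

(** The left side is the sum of the traces of the two diagonal blocks of [jacobian]: [Aw], [Am],
    [AI], [Aq] stand for [ad_mx] of omega, m, omega J and omega Q, [Om] for omega itself and [W] for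
    [wedge_mx]. The contributions of tr (C Am) from the two blocks cancel. *)
Lemma mxtrace_rolling (e : R) :
  \tr (- e *: (- (W *m (Aq *m P - (Am - Aw)) *m C *m W^T) - Om))
  + \tr (e *: (- Aw + C *m Am)
         + (1 - e) *: ((- (C *m ((1%:M + Q) *m Aw)) + C *m AI) *m P))
  = - (1 - e *+ 2) * \tr (C *m Aw).
Proof.
have hT : (Am - Aw)^T = - (Am - Aw) by rewrite linearB /= hm hw opprB opprK addrC.
have t1 T : T^T = - T ->
    \tr (W *m (Aq *m P - T) *m C *m W^T) = - \tr (C *m T).
  move=> {}hT.
  have -> : \tr (W *m (Aq *m P - T) *m C *m W^T) =
            \tr (P *m C *m P *m Aq) - \tr (C *m P *m T).
    rewrite mxtrace_mulC !mulmxA WW mxtrace_mulC mulmxA [C *m P *m (_ - _)]mulmxBr mxtraceB.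
    by rewrite mulmxA [\tr (_ *m P)]mxtrace_mulC !mulmxA.
  (* P C P = P C is symmetric, so the term with [Aq] drops out. *)
  rewrite -[P *m C *m P]mulmxA resolvent_CP mulmxDr mulmxBr mulmx1 PP subrK.
  rewrite mxtrace_sym_skew // ?resolvent_PC_sym //.
  rewrite mulmxDl mulmxBl mul1mx.
  rewrite mxtraceD mxtraceB (mxtrace_skew hT) (mxtrace_sym_skew Psym hT).
  by rewrite subr0 addr0 sub0r.
have t2 : \tr (C *m AI *m P) = 0.
  by rewrite mxtrace_mulC mulmxA mxtrace_sym_skew // resolvent_PC_sym.
have t3 : \tr (C *m ((1%:M + Q) *m Aw) *m P) = \tr (C *m Aw).
  rewrite mxtrace_mulC !mulmxA mulmxDr mulmx1 resolvent_PCQ.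
  rewrite !mulmxDl mulNmx mul1mx !mxtraceD [\tr (- _)]mxtraceN.
  rewrite mxtrace_tr_skew // (mxtrace_skew hw) (mxtrace_sym_skew resolvent_PC_sym hw).
  lra.
rewrite mxtraceZ [\tr (e *: _ + _)]mxtraceD !mxtraceZ [(_ + _) *m P]mulmxDl mulNmx.
rewrite [\tr (- _ - _)]mxtraceB [\tr (- (C *m _ *m P) + _)]mxtraceD.
rewrite [\tr (- Aw + _)]mxtraceD !mxtraceN (t1 _ hT) t2 t3.
rewrite [C *m (Am - Aw)]mulmxBr mxtraceB.
by rewrite (mxtrace_skew Om_skew) (mxtrace_skew hw); ring.
Qed.

End TraceIdentities.

(** * Sylvester's determinant identity *)

Section Sylvester.
Variables (R : comNzRingType) (m n : nat).

(** One block matrix, multiplied by two different unipotent block triangular matrices, becomes block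
    triangular with either determinant on its diagonal. *)
Lemma det_1pmulC (A : 'M[R]_(m, n)) (B : 'M[R]_(n, m)) :
  \det (1%:M + A *m B) = \det (1%:M + B *m A).
Proof.
pose X := block_mx (1%:M : 'M[R]_m) (- A) B (1%:M : 'M[R]_n).
have e1 : X *m block_mx 1%:M A 0 1%:M = block_mx 1%:M 0 B (1%:M + B *m A).
  rewrite mulmx_block !(mulmx1, mul1mx, mulmx0, mul0mx, addr0) subrr.
  by rewrite [B *m A + _]addrC.
have e2 : X *m block_mx 1%:M 0 (- B) 1%:M = block_mx (1%:M + A *m B) (- A) 0 1%:M.
  rewrite mulmx_block !(mulmx1, mul1mx, mulmx0, mul0mx, addr0, add0r) subrr.
  by rewrite mulNmx mulmxN opprK.
have := congr1 determinant e1; have := congr1 determinant e2.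
rewrite !det_mulmx !det_lblock !det_ublock !det1 !mulr1 !mul1r.
by move=> <- <-.
Qed.

End Sylvester.

(** * Entrywise estimates *)

Section EntrySum.
Variable R : realType.

(* The entrywise l1 norm: submultiplicative without dimension constants. *)
Definition mx_l1 m n (M : 'M[R]_(m, n)) : R := \sum_i \sum_j `|M i j|.

Lemma mx_l1_ge0 m n (M : 'M[R]_(m, n)) : 0 <= mx_l1 M.
Proof. by apply: sumr_ge0 => i _; apply: sumr_ge0. Qed.

Lemma entry_le_mx_l1 m n (M : 'M[R]_(m, n)) i j : `|M i j| <= mx_l1 M.
Proof.
rewrite /mx_l1 (bigD1 i) //= (bigD1 j) //= -addrA lerDl.
by rewrite addr_ge0 // ?sumr_ge0 // => k _; rewrite sumr_ge0.
Qed.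

Lemma mx_l1_0 m n : mx_l1 (0 : 'M[R]_(m, n)) = 0.
Proof. by rewrite /mx_l1 big1 // => i _; rewrite big1 // => j _; rewrite mxE normr0. Qed.

Lemma mx_l1D m n (M N : 'M[R]_(m, n)) : mx_l1 (M + N) <= mx_l1 M + mx_l1 N.
Proof.
rewrite /mx_l1 -big_split ler_sum // => i _; rewrite -big_split ler_sum // => j _.
by rewrite mxE ler_normD.
Qed.

Lemma mx_l1N m n (M : 'M[R]_(m, n)) : mx_l1 (- M) = mx_l1 M.
Proof. by apply: eq_bigr => i _; apply: eq_bigr => j _; rewrite mxE normrN. Qed.

Lemma mx_l1Z m n a (M : 'M[R]_(m, n)) : mx_l1 (a *: M) = `|a| * mx_l1 M.
Proof.
rewrite /mx_l1 mulr_sumr; apply: eq_bigr => i _; rewrite mulr_sumr.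
by apply: eq_bigr => j _; rewrite mxE normrM.
Qed.

Lemma mx_l1_sum m n (I : Type) (r : seq I) (F : I -> 'M[R]_(m, n)) :
  mx_l1 (\sum_(i <- r) F i) <= \sum_(i <- r) mx_l1 (F i).
Proof.
elim/big_rec2: _ => [|i y1 y2 _ h]; first by rewrite mx_l1_0.
by rewrite (le_trans (mx_l1D _ _)) // lerD2l.
Qed.

Lemma mx_l1_tr m n (M : 'M[R]_(m, n)) : mx_l1 M^T = mx_l1 M.
Proof.
rewrite /mx_l1 exchange_big; apply: eq_bigr => i _; apply: eq_bigr => j _.
by rewrite mxE.
Qed.

Lemma mx_l1M m n p (M : 'M[R]_(m, n)) (N : 'M[R]_(n, p)) :
  mx_l1 (M *m N) <= mx_l1 M * mx_l1 N.
Proof.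
rewrite /mx_l1 mulr_suml ler_sum // => i _.
apply: (@le_trans _ _ (\sum_j \sum_k `|M i k| * `|N k j|)).
  apply: ler_sum => j _; rewrite mxE (le_trans (ler_norm_sum _ _ _)) //.
  by apply: ler_sum => k _; rewrite normrM.
rewrite exchange_big mulr_suml ler_sum //= => k _; rewrite -mulr_sumr ler_wpM2l //.
by rewrite [leRHS](bigD1 k) //= lerDl !sumr_ge0 // => l _; rewrite sumr_ge0.
Qed.

Lemma mx_l1_linear m n p q (F : {linear 'M[R]_(m, n) -> 'M[R]_(p, q)}) :
  exists2 L, 0 <= L & forall M, mx_l1 (F M) <= L * mx_l1 M.
Proof.
exists (\sum_i \sum_j mx_l1 (F (delta_mx i j))).
  by do 2 (apply: sumr_ge0 => ? _); exact: mx_l1_ge0.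
move=> M; rewrite {1}(matrix_sum_delta M) linear_sum (le_trans (mx_l1_sum _ _)) //.
rewrite mulr_suml ler_sum // => i _.
rewrite linear_sum (le_trans (mx_l1_sum _ _)) // mulr_suml ler_sum // => j _.
by rewrite linearZ mx_l1Z mulrC ler_wpM2l ?mx_l1_ge0 ?entry_le_mx_l1.
Qed.

Lemma mx_l1_row_mx m n p (M : 'M[R]_(m, n)) (N : 'M[R]_(m, p)) :
  mx_l1 (row_mx M N) = mx_l1 M + mx_l1 N.
Proof.
rewrite /mx_l1 -big_split; apply: eq_bigr => i _; rewrite big_split_ord /=.
by congr (_ + _); apply: eq_bigr => j _; rewrite ?row_mxEl ?row_mxEr.
Qed.

Lemma mx_l1_col_mx m n p (M : 'M[R]_(m, n)) (N : 'M[R]_(p, n)) :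
  mx_l1 (col_mx M N) = mx_l1 M + mx_l1 N.
Proof. by rewrite -mx_l1_tr tr_col_mx mx_l1_row_mx !mx_l1_tr. Qed.

End EntrySum.

(** * Calculus of uniform O-estimates *)

Section BoundedBy.
Variables (R : realType) (T : Type) (D : T -> Prop).
Implicit Types e : T -> R.

(** The relation f = O(e), uniformly on [D] and without any limit; it will be applied to pairs of
    points of the phase space, with e a power of their distance. *)
Definition bounded_by m n e (f : T -> 'M[R]_(m, n)) :=
  exists2 L, 0 <= L & forall t, D t -> mx_l1 (f t) <= L * e t.

Lemma bounded_by_cst m n (M : 'M[R]_(m, n)) : bounded_by (fun=> 1) (fun=> M).
Proof. by exists (mx_l1 M); rewrite ?mx_l1_ge0 // => t _; rewrite mulr1. Qed.

Lemma bounded_byD m n e (f g : T -> 'M[R]_(m, n)) :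
  bounded_by e f -> bounded_by e g -> bounded_by e (fun t => f t + g t).
Proof.
move=> [L L0 hL] [K K0 hK]; exists (L + K); first exact: addr_ge0.
by move=> t Dt; rewrite (le_trans (mx_l1D _ _)) // mulrDl lerD ?hL ?hK.
Qed.

Lemma bounded_byN m n e (f : T -> 'M[R]_(m, n)) :
  bounded_by e f -> bounded_by e (fun t => - f t).
Proof. by move=> [L L0 hL]; exists L => // t Dt; rewrite mx_l1N hL. Qed.

Lemma bounded_byB m n e (f g : T -> 'M[R]_(m, n)) :
  bounded_by e f -> bounded_by e g -> bounded_by e (fun t => f t - g t).
Proof. by move=> hf hg; apply: bounded_byD => //; apply: bounded_byN. Qed.

Lemma bounded_byZ m n e a (f : T -> 'M[R]_(m, n)) :
  bounded_by e f -> bounded_by e (fun t => a *: f t).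
Proof.
move=> [L L0 hL]; exists (`|a| * L); first by rewrite mulr_ge0.
by move=> t Dt; rewrite mx_l1Z -mulrA ler_wpM2l ?hL.
Qed.

Lemma bounded_by_tr m n e (f : T -> 'M[R]_(m, n)) :
  bounded_by e f -> bounded_by e (fun t => (f t)^T).
Proof. by move=> [L L0 hL]; exists L => // t Dt; rewrite mx_l1_tr hL. Qed.

Lemma bounded_by_lin m n p q e (F : {linear 'M[R]_(m, n) -> 'M[R]_(p, q)}) f :
  bounded_by e f -> bounded_by e (fun t => F (f t)).
Proof.
have [K K0 hK] := mx_l1_linear F.
move=> [L L0 hL]; exists (K * L); first by rewrite mulr_ge0.
by move=> t Dt; rewrite (le_trans (hK _)) // -mulrA ler_wpM2l ?hL.
Qed.

Lemma bounded_byM m n p e1 e2 e (f : T -> 'M[R]_(m, n)) (g : T -> 'M[R]_(n, p)) :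
  (forall t, D t -> e1 t * e2 t <= e t) ->
  bounded_by e1 f -> bounded_by e2 g -> bounded_by e (fun t => f t *m g t).
Proof.
move=> he [L L0 hL] [K K0 hK]; exists (L * K); first exact: mulr_ge0.
move=> t Dt; rewrite (le_trans (mx_l1M _ _)) //.
apply: (@le_trans _ _ (L * e1 t * (K * e2 t))).
  by apply: ler_pM; rewrite ?mx_l1_ge0 ?hL ?hK.
by rewrite mulrACA ler_wpM2l ?mulr_ge0 ?he.
Qed.

Lemma bounded_byW m n e1 e2 (f : T -> 'M[R]_(m, n)) :
  (forall t, D t -> e1 t <= e2 t) -> bounded_by e1 f -> bounded_by e2 f.
Proof.
move=> he [L L0 hL]; exists L => // t Dt.
by rewrite (le_trans (hL _ Dt)) // ler_wpM2l ?he.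
Qed.

Lemma bounded_by_ext m n e (f g : T -> 'M[R]_(m, n)) :
  (forall t, D t -> f t = g t) -> bounded_by e f -> bounded_by e g.
Proof. by move=> fg [L L0 hL]; exists L => // t Dt; rewrite -fg ?hL. Qed.

Lemma bounded_byMl m n p e (f : T -> 'M[R]_(m, n)) (g : T -> 'M[R]_(n, p)) :
  bounded_by e f -> bounded_by (fun=> 1) g -> bounded_by e (fun t => f t *m g t).
Proof. by apply: bounded_byM => t _; rewrite mulr1. Qed.

Lemma bounded_byMr m n p e (f : T -> 'M[R]_(m, n)) (g : T -> 'M[R]_(n, p)) :
  bounded_by (fun=> 1) f -> bounded_by e g -> bounded_by e (fun t => f t *m g t).
Proof. by apply: bounded_byM => t _; rewrite mul1r. Qed.

End BoundedBy.

(** * Matrix coordinates on so(n) *)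

Section SoCoordinates.
Variables (R : realType) (n : nat).
Local Notation K := #|@upper_pairs n|.
Implicit Types (X Y Z : 'M[R]_n.+1) (x y z s : 'rV[R]_K) (g h u : 'rV[R]_n.+1).

Lemma upper_pairP (k : 'I_K) : ((enum_val k).1 < (enum_val k).2)%N.
Proof. by have := enum_valP k; rewrite inE. Qed.

Lemma upper_pair_neq (k l : 'I_K) :
  ((enum_val k).1 == (enum_val l).2) && ((enum_val k).2 == (enum_val l).1) = false.
Proof.
apply/negP => /andP[/eqP e1 /eqP e2].
by have := upper_pairP k; rewrite e1 e2 ltnNge ltnW // upper_pairP.
Qed.

Lemma upper_pair_eq (k l : 'I_K) :
  ((enum_val k).1 == (enum_val l).1) && ((enum_val k).2 == (enum_val l).2) = (k == l).
Proof. by rewrite -(inj_eq enum_val_inj) -pair_eqE. Qed.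

Definition so_basis (k : 'I_K) : 'M[R]_n.+1 :=
  wedge (basis_vec (enum_val k).1) (basis_vec (enum_val k).2).

Definition so_of x : 'M[R]_n.+1 := \sum_k x 0 k *: so_basis k.

Lemma so_of_is_linear : linear so_of.
Proof.
move=> a x y; rewrite /so_of scaler_sumr -big_split; apply: eq_bigr => k _.
by rewrite !mxE scalerDl scalerA.
Qed.
HB.instance Definition _ := GRing.isLinear.Build R 'rV[R]_K 'M[R]_n.+1 _ so_of so_of_is_linear.

Lemma so_coords_is_linear : linear (@so_coords R n).
Proof. by move=> a X Y; apply/rowP => k; rewrite !mxE. Qed.
HB.instance Definition _ :=
  GRing.isLinear.Build R 'M[R]_n.+1 'rV[R]_K _ (@so_coords R n) so_coords_is_linear.

Lemma so_wedge (a b : 'cV[R]_n.+1) : so n.+1 (wedge a b).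
Proof. by rewrite /so /wedge /= linearB /= !trmx_mul !trmxK opprB. Qed.

Lemma so_lin a X Y : so n.+1 X -> so n.+1 Y -> so n.+1 (a *: X + Y).
Proof. by rewrite /so /= => hX hY; rewrite linearP /= hX hY scalerN opprD. Qed.

Lemma so_bracket X Y : so n.+1 X -> so n.+1 Y -> so n.+1 (lie_bracket X Y).
Proof.
rewrite /so /lie_bracket /= => hX hY.
by rewrite linearB /= !trmx_mul hX hY !mulNmx !mulmxN !opprK opprB.
Qed.

Lemma so0 : so n.+1 (0 : 'M[R]_n.+1).
Proof. by rewrite /so /= trmx0 oppr0. Qed.

Lemma so_of_so x : so n.+1 (so_of x).
Proof.
rewrite /so_of; elim/big_ind: _ => [|X Y hX hY|k _]; first exact: so0.
  by rewrite -[X]scale1r; apply: so_lin.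
by rewrite -[_ *: _]addr0; apply: so_lin; [exact: so_wedge|exact: so0].
Qed.
Hint Resolve so_of_so so_wedge : core.

Lemma wedgeE (a b : 'cV[R]_n.+1) i j : wedge a b i j = a i 0 * b j 0 - b i 0 * a j 0.
Proof. by rewrite !mxE !big_ord_recl !big_ord0 !mxE !addr0. Qed.

Lemma so_ofK : cancel so_of (@so_coords R n).
Proof.
move=> x; apply/rowP => k; rewrite mxE /so_of summxE (bigD1 k) //= big1 ?addr0.
  rewrite mxE wedgeE !mxE !eqxx !andbT -!natrM !mulnb !andTb.
  by rewrite upper_pair_neq subr0 mulr1.
move=> l lk; rewrite mxE wedgeE !mxE !eqxx !andbT -!natrM !mulnb.
by rewrite upper_pair_eq upper_pair_neq eq_sym (negbTE lk) subr0 mulr0.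
Qed.

Lemma so_coords_inj X : so n.+1 X -> so_coords X = 0 -> X = 0.
Proof.
move=> /= hX cX.
have up (i j : 'I_n.+1) : (i < j)%N -> X i j = 0.
  move=> ij; have ijU : (i, j) \in @upper_pairs n by rewrite inE.
  have /rowP/(_ (enum_rank_in ijU (i, j))) := cX.
  by rewrite !mxE enum_rankK_in.
have sk (i j : 'I_n.+1) : X i j = - X j i by have /matrixP/(_ j i) := hX; rewrite !mxE.
apply/matrixP => i j; rewrite [RHS]mxE; case: (ltngtP i j) => [ij|ij|/val_inj->].
- exact: up.
- by rewrite sk up // oppr0.
- by have := sk j j; lra.
Qed.

Lemma so_coordsK X : so n.+1 X -> so_of (so_coords X) = X.
Proof.
move=> hX; apply/eqP; rewrite -subr_eq0; apply/eqP/so_coords_inj.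
  by rewrite -[X in _ - X]scale1r -scaleNr addrC; apply: so_lin.
by rewrite linearB /= so_ofK subrr.
Qed.

Lemma so_dot_wedge X (a b : 'cV[R]_n.+1) : so n.+1 X ->
  so_dot X (wedge a b) = (a^T *m X *m b) 0 0.
Proof.
move=> /= hX; rewrite /so_dot /wedge mulmxBr raddfB /= !mulmxA.
rewrite [\tr (X *m a *m _)]mxtrace_mulC [\tr (X *m b *m _)]mxtrace_mulC.
rewrite !trace_mx11 !mulmxA.
have -> : (b^T *m X *m a) 0 0 = - (a^T *m X *m b) 0 0.
  have -> : (b^T *m X *m a) 0 0 = (b^T *m X *m a)^T 0 0 by rewrite [RHS]mxE.
  by rewrite !trmx_mul trmxK hX mulNmx mulmxN mulmxA mxE.
lra.
Qed.

Lemma so_coordsE X k : so_coords X 0 k = X (enum_val k).1 (enum_val k).2.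
Proof. by rewrite mxE. Qed.

Lemma so_dot_basis X k : so n.+1 X -> so_dot X (so_basis k) = so_coords X 0 k.
Proof.
move=> hX; rewrite so_dot_wedge // so_coordsE /basis_vec trmx_delta -rowE -colE.
by rewrite !mxE.
Qed.

(** The basis is orthonormal, so adjoints for [so_dot] become transposes in coordinates. *)
Lemma so_dotE X Y : so n.+1 X -> so n.+1 Y ->
  so_dot X Y = (so_coords X *m (so_coords Y)^T) 0 0.
Proof.
move=> hX hY; rewrite -{1}(so_coordsK hY) mxE /so_dot /so_of.
rewrite mulmx_sumr raddf_sum /= mulr_sumr; apply: eq_bigr => k _.
rewrite -scalemxAr mxtraceZ mulrCA -/(so_dot X (so_basis k)) so_dot_basis //.
by rewrite [RHS]mulrC [(so_coords Y)^T _ _]mxE.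
Qed.

Definition wedge_mx g : 'M[R]_(n.+1, K) :=
  \matrix_i so_coords (wedge (basis_vec i) g^T).

Lemma wedge_mxE g i k : wedge_mx g i k =
  ((enum_val k).1 == i)%:R * g 0 (enum_val k).2
  - g 0 (enum_val k).1 * ((enum_val k).2 == i)%:R.
Proof. by rewrite [LHS]mxE so_coordsE wedgeE !mxE eqxx !andbT. Qed.

Lemma mul_wedge_mx u g : u *m wedge_mx g = so_coords (wedge u^T g^T).
Proof.
apply/rowP => k; rewrite so_coordsE wedgeE ![u^T _ _]mxE ![g^T _ _]mxE [LHS]mxE.
under eq_bigr do rewrite wedge_mxE mulrBr.
rewrite sumrB (bigD1 (enum_val k).1) //= eqxx mul1r big1 ?addr0; last first.
  by move=> i ik; rewrite eq_sym (negbTE ik) mul0r mulr0.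
rewrite (bigD1 (enum_val k).2) //= eqxx mulr1 big1 ?addr0; last first.
  by move=> i ik; rewrite [_ == i]eq_sym (negbTE ik) !mulr0.
by rewrite [u 0 _ * _ in X in _ - X]mulrC.
Qed.

Lemma wedge_mx_is_linear : linear wedge_mx.
Proof.
by move=> a g h; apply/matrixP => i k; rewrite wedge_mxE [RHS]mxE [X in _ = X + _]mxE !wedge_mxE !mxE; ring.
Qed.
HB.instance Definition _ :=
  GRing.isLinear.Build R 'rV[R]_n.+1 'M[R]_(n.+1, K) _ wedge_mx wedge_mx_is_linear.

Lemma mulmx_wedge_mx_self g : g *m wedge_mx g = 0.
Proof. by rewrite mul_wedge_mx /wedge subrr linear0. Qed.

(** The adjoint of x |-> x /\ g for [so_dot] is X |-> X g. *)
Lemma mul_wedge_mx_tr X g : so n.+1 X ->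
  so_coords X *m (wedge_mx g)^T = (X *m g^T)^T.
Proof.
move=> hX; apply/rowP => i; rewrite [RHS]mxE.
have -> : (so_coords X *m (wedge_mx g)^T) 0 i =
          (so_coords X *m (so_coords (wedge (basis_vec i) g^T))^T) 0 0.
  by rewrite !mxE; apply: eq_bigr => k _; rewrite !mxE.
by rewrite -so_dotE // so_dot_wedge // /basis_vec trmx_delta -rowE -row_mul mxE.
Qed.

(** This turns the velocity of g under a rotation into a product with the transpose of [wedge_mx],
    the form used in [rolling_field]. *)
Lemma so_coords_tr_wedge x g : x *m (wedge_mx g)^T = - (g *m so_of x).
Proof.
rewrite -{1}[x]so_ofK mul_wedge_mx_tr // trmx_mul trmxK.
by have /= -> := so_of_so x; rewrite mulmxN.
Qed.

Lemma wedge_mx_tr_mul g :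
  wedge_mx g *m (wedge_mx g)^T = (g *m g^T) 0 0 *: 1%:M - g^T *m g.
Proof.
apply/row_matrixP => i; rewrite row_mul rowK mul_wedge_mx_tr //.
rewrite /wedge mulmxBl -!mulmxA trmxK linearB /= linearB /= linearZ /=.
have gg : g *m g^T = ((g *m g^T) 0 0)%:M by exact: mx11_scalar.
rewrite [in LHS]gg mul_mx_scalar linearZ /= row1 /basis_vec trmx_delta; congr (_ - _).
rewrite trmx_mul trmxK -rowE row_mul; congr (_ *m _).
by apply/matrixP => a b; rewrite !ord1 mxE.
Qed.

(** For skew X the projection is (X g) /\ g: the adjoint of x |-> x /\ g followed by that map. The
    factorization W^T W is what makes Sylvester's identity applicable later. *)
Lemma so_coords_pr_v X g : so n.+1 X ->
  so_coords (pr_v g^T X) = so_coords X *m ((wedge_mx g)^T *m wedge_mx g).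
Proof.
move=> hX; rewrite mulmxA mul_wedge_mx_tr // mul_wedge_mx trmxK /pr_v /wedge /tensor.
by rewrite trmx_mul hX !mulmxN opprK !mulmxA trmxK.
Qed.

Definition ad_mx x : 'M[R]_K :=
  \matrix_k so_coords (lie_bracket (so_of x) (so_basis k)).

Lemma mul_ad_mx y x : y *m ad_mx x = so_coords (lie_bracket (so_of x) (so_of y)).
Proof.
rewrite mulmx_sum_row /lie_bracket {3 4}/so_of mulmx_sumr mulmx_suml -sumrB linear_sum.
apply: eq_bigr => k _; rewrite rowK -linearZ /=; congr so_coords.
by rewrite /lie_bracket scalerBr -scalemxAr -scalemxAl.
Qed.

Lemma ad_mx_is_linear : linear ad_mx.
Proof.
move=> a x y; apply/row_matrixP => k; rewrite linearP /= !rowK -linearP /=; congr so_coords.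
move: (so_basis k) => E.
rewrite /lie_bracket linearP /= mulmxDl mulmxDr scalerBr scalemxAl.
by rewrite [a *: (E *m _)]scalemxAr opprD addrACA.
Qed.
HB.instance Definition _ :=
  GRing.isLinear.Build R 'rV[R]_K 'M[R]_K _ ad_mx ad_mx_is_linear.

Lemma ad_mx_anti x y : x *m ad_mx y = - (y *m ad_mx x).
Proof. by rewrite !mul_ad_mx -linearN /= /lie_bracket opprB. Qed.

Lemma so_dot_bracket X Y Z :
  so_dot (lie_bracket X Y) Z = - so_dot Y (lie_bracket X Z).
Proof.
rewrite /so_dot /lie_bracket mulmxBl mulmxBr !raddfB /= !mulmxA.
by rewrite -[X *m Y *m Z]mulmxA [\tr (X *m _)]mxtrace_mulC; ring.
Qed.

(** Infinitesimal invariance of the trace form, in an orthonormal basis. *)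
Lemma ad_mx_skew x : (ad_mx x)^T = - ad_mx x.
Proof.
have e i j : ad_mx x i j = so_dot (lie_bracket (so_of x) (so_basis i)) (so_basis j).
  by rewrite [LHS]mxE so_dot_basis //; apply: so_bracket; [exact: so_of_so|exact: so_wedge].
have dC X Y : so_dot X Y = so_dot Y X by rewrite /so_dot mxtrace_mulC.
by apply/matrixP => i j; rewrite [LHS]mxE [RHS]mxE !e so_dot_bracket dC.
Qed.

(** Leibniz rule for a skew S: [S, x /\ g] = (S x) /\ g + x /\ (S g), solved for the last term. *)
Lemma wedge_mx_rot x g :
  wedge_mx (x *m (wedge_mx g)^T) = wedge_mx g *m ad_mx x + so_of x *m wedge_mx g.
Proof.
apply/row_matrixP => i; rewrite linearD /= !row_mul !rowK mul_ad_mx so_coordsK //.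
rewrite mul_wedge_mx -linearD /=; congr so_coords.
rewrite so_coords_tr_wedge /lie_bracket /wedge.
have hx : (so_of x)^T = - so_of x by have := so_of_so x.
have hr : (row i (so_of x))^T = - (so_of x *m basis_vec i).
  by rewrite rowE trmx_mul hx trmx_delta mulNmx.
rewrite hr linearN /= trmx_mul hx mulNmx opprK !trmxK.
have -> : (so_of x *m g^T)^T = - (g *m so_of x) by rewrite trmx_mul trmxK hx mulmxN.
have -> : (- (so_of x *m basis_vec i))^T = (basis_vec i)^T *m so_of x.
  by rewrite linearN /= trmx_mul hx mulmxN opprK.
rewrite mulmxBr mulmxBl !mulmxN !mulNmx !mulmxA.
move: (_ *m g *m _) (_ *m g^T *m _) (_ *m _ *m g) (g^T *m _ *m _) => A B C E.
by apply/matrixP => a b; rewrite !mxE; ring.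
Qed.

(* Tangential part by rotation, radial part by homogeneity. *)
Lemma wedge_mx_unit u g : (g *m g^T) 0 0 = 1 ->
  wedge_mx u = wedge_mx g *m ad_mx (u *m wedge_mx g)
             + so_of (u *m wedge_mx g) *m wedge_mx g
             + (u *m g^T) 0 0 *: wedge_mx g.
Proof.
move=> g1; rewrite -wedge_mx_rot -linearZ -linearD /=; congr wedge_mx.
rewrite -mulmxA wedge_mx_tr_mul g1 scale1r mulmxBr mulmx1 mulmxA.
by rewrite {1}[u *m g^T]mx11_scalar mul_scalar_mx subrK.
Qed.

End SoCoordinates.

(** * Calculus on the unit interval *)

Section RealCalculus.
Variable R : realType.
Implicit Types (f g df : R -> R) (x a b : R).

Lemma is_derive1D f g x a b : is_derive x 1 f a -> is_derive x 1 g b ->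
  is_derive x 1 (fun t => f t + g t) (a + b).
Proof. by move=> hf hg; exact: is_deriveD. Qed.

Lemma is_derive1B f g x a b : is_derive x 1 f a -> is_derive x 1 g b ->
  is_derive x 1 (fun t => f t - g t) (a - b).
Proof. by move=> hf hg; exact: is_deriveB. Qed.

Lemma is_derive1M f g x a b : is_derive x 1 f a -> is_derive x 1 g b ->
  is_derive x 1 (fun t => f t * g t) (f x * b + g x * a).
Proof. by move=> hf hg; exact: is_deriveM. Qed.

Lemma is_derive1Z (k : R) f x a : is_derive x 1 f a ->
  is_derive x 1 (fun t => k * f t) (k * a).
Proof. by move=> hf; exact: is_deriveZ. Qed.

Lemma is_derive1_sum (I : Type) (r : seq I) (P : pred I) (h : I -> R -> R)
    (dh : I -> R) x : (forall i, is_derive x 1 (h i) (dh i)) ->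
  is_derive x 1 (fun t => \sum_(i <- r | P i) h i t) (\sum_(i <- r | P i) dh i).
Proof.
move=> H; elim: r => [|i r IH].
  rewrite big_nil; under eq_fun do rewrite big_nil; exact: is_derive_cst.
rewrite big_cons; under eq_fun do rewrite big_cons.
by case: (P i) => //; exact: is_derive1D.
Qed.

Lemma is_derive1_prod n (h : 'I_n -> R -> R) (dh : 'I_n -> R) x :
  (forall i, is_derive x 1 (h i) (dh i)) ->
  is_derive x 1 (fun t => \prod_i h i t)
    (\sum_i dh i * \prod_(j | j != i) h j x).
Proof.
elim: n h dh => [|n IH] h dh H.
  rewrite big_ord0; under eq_fun do rewrite big_ord0; exact: is_derive_cst.
under eq_fun do rewrite big_ord_recl.
have := is_derive1M (H ord0) (IH _ _ (fun i => H (lift ord0 i))).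
move=> /is_derive_eq; apply.
rewrite big_ord_recl addrC; congr (_ + _).
  rewrite mulrC; congr (_ * _); rewrite [RHS]big_mkcond big_ord_recl /= mul1r.
  by apply: eq_bigr.
rewrite mulr_sumr; apply: eq_bigr => i _; rewrite mulrCA; congr (_ * _).
by rewrite [RHS]big_mkcond big_ord_recl /= big_mkcond; congr (_ * _).
Qed.

(** The sum is the determinant of [W] with its row i replaced by that of [V], expanded along this
    row. *)
Lemma det_sum_row n (W V : 'M[R]_n) i :
  \sum_(s : 'S_n) (-1) ^+ s * (V i (s i) * \prod_(j | j != i) W j (s j)) =
  \sum_k V i k * cofactor W i k :> R.
Proof.
pose U := \matrix_(a, b) (if a == i then V a b else W a b).
have -> : \sum_(s : 'S_n) (-1) ^+ s * (V i (s i) * \prod_(j | j != i) W j (s j)) = \det U.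
  apply: eq_bigr => s _; rewrite [in RHS](bigD1 i) //= mxE eqxx.
  by congr (_ * (_ * _)); apply: eq_bigr => j /negbTE ji; rewrite mxE ji.
rewrite (expand_det_row U i); apply: eq_bigr => k _; rewrite mxE eqxx.
congr (_ * (_ * \det _)); apply/matrixP => a b; rewrite !mxE.
by rewrite eq_sym (negbTE (neq_lift _ _)).
Qed.

Lemma is_derive1_det n (W : R -> 'M[R]_n) (dW : 'M[R]_n) x :
  (forall i j, is_derive x 1 (fun t => W t i j) (dW i j)) ->
  is_derive x 1 (fun t => \det (W t)) (\tr (dW *m \adj (W x))).
Proof.
move=> H; rewrite /determinant.
have := @is_derive1_sum _ (index_enum _) xpredT
  (fun (s : 'S_n) t => (-1) ^+ s * \prod_i W t i (s i))
  (fun s => (-1) ^+ s * \sum_i dW i (s i) * \prod_(j | j != i) W x j (s j)) x.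
move=> /(_ _)/is_derive_eq; apply.
  by move=> s; apply: is_derive1Z; apply: is_derive1_prod.
under eq_bigr do rewrite mulr_sumr.
rewrite exchange_big /=; apply: eq_bigr => i _; rewrite det_sum_row mxE.
by apply: eq_bigr => k _; rewrite mxE.
Qed.

Lemma det_le n (M : 'M[R]_n) b : (forall i j, `|M i j| <= b) ->
  `|\det M| <= n`!%:R * b ^+ n.
Proof.
move=> hM; rewrite (le_trans (ler_norm_sum _ _ _)) //.
apply: (@le_trans _ _ (\sum_(s : 'S_n) b ^+ n)); last first.
  by rewrite sumr_const card_Sn mulr_natl.
apply: ler_sum => s _; rewrite normrM normrX normrN1 expr1n mul1r normr_prod.
rewrite -[X in b ^+ X]card_ord -prodr_const; apply: ler_prod => i _.
by rewrite normr_ge0 hM.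
Qed.

Lemma adj_bounded n b : exists2 L, 0 <= L &
  forall M : 'M[R]_n, mx_l1 M <= b -> mx_l1 (\adj M) <= L.
Proof.
exists (\sum_(i < n) \sum_(j < n) (n.-1)`!%:R * `|b| ^+ n.-1).
  by do 2 (apply: sumr_ge0 => ? _); rewrite mulr_ge0 ?exprn_ge0.
move=> M hM; apply: ler_sum => i _; apply: ler_sum => j _.
rewrite mxE /cofactor normrM normrX normrN1 expr1n mul1r det_le // => k l.
rewrite !mxE (le_trans (entry_le_mx_l1 _ _ _)) // (le_trans hM) //.
exact: ler_norm.
Qed.

Lemma trace_le n (M : 'M[R]_n) : `|\tr M| <= mx_l1 M.
Proof.
rewrite (le_trans (ler_norm_sum _ _ _)) // ler_sum // => i _.
by rewrite (bigD1 i) //= lerDl sumr_ge0.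
Qed.

Lemma derive_within f df x : 0 <= x -> x <= 1 ->
  (forall t : R, 0 <= t <= 1 -> is_derive t 1 f (df t)) ->
  {within `[0, x], continuous f}.
Proof.
move=> x0 x1 H; apply: derivable_within_continuous => t.
rewrite in_itv /= => /andP[t0 tx].
by have [] := H t; rewrite ?t0 ?(le_trans tx x1).
Qed.

Lemma mvt01 f df x : 0 <= x <= 1 ->
  (forall t : R, 0 <= t <= 1 -> is_derive t 1 f (df t)) ->
  exists2 c, 0 <= c <= 1 & f x - f 0 = df c * x.
Proof.
move=> /andP[x0 x1] H.
have [|c] := @MVT_segment R f df 0 x x0 _ (derive_within x0 x1 H).
  move=> t; rewrite in_itv /= => /andP[t0 tx]; apply: H.
  by rewrite (ltW t0) (le_trans (ltW tx)).
rewrite in_itv /= subr0 => /andP[c0 cx] e; exists c => //.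
by rewrite c0 (le_trans cx).
Qed.

Lemma derive_bounded f df :
  (forall t : R, 0 <= t <= 1 -> is_derive t 1 f (df t)) ->
  exists2 L, 0 <= L & forall t : R, 0 <= t <= 1 -> `|f t| <= L.
Proof.
move=> H; have cf := derive_within ler01 (lexx 1) H.
have [c _ hc] := EVT_max ler01 cf; have [d _ hd] := EVT_min ler01 cf.
exists (`|f c| + `|f d|); first by rewrite addr_ge0.
move=> t t01; have ti : t \in `[0, 1]%R by rewrite in_itv.
have := hc _ ti; have := hd _ ti.
rewrite ler_norml => h1 h2; apply/andP; split.
  by have := ler_norm (- f d); rewrite normrN; have := normr_ge0 (f c); lra.
by have := ler_norm (f c); have := normr_ge0 (f d); lra.
Qed.

Lemma gronwall f df a b : 1 <= a -> 0 <= b -> 0 <= f 0 ->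
  (forall t : R, 0 <= t <= 1 -> is_derive t 1 f (df t)) ->
  (forall t : R, 0 <= t <= 1 -> df t <= a * f t + b) ->
  forall t : R, 0 <= t <= 1 -> f t <= (f 0 + b) * expR a.
Proof.
move=> a1 b0 f0 H dfle t t01.
have a0 : a != 0 by rewrite gt_eqF // (lt_le_trans _ a1).
pose g s := (f s + b / a) * expR (- a * s).
pose dg s := (f s + b / a) * (- a * expR (- a * s)) + expR (- a * s) * df s.
have Hg (s : R) : 0 <= s <= 1 -> is_derive s 1 g (dg s).
  move=> s01; apply: is_derive1M.
    by rewrite -[df s]addr0; exact: is_derive1D (H _ s01) (is_derive_cst (b / a) s 1).
  have h : is_derive s 1 (fun y => - a * y) (- a * 1) by apply: is_derive1Z; exact: is_derive_id.
  have := @is_derive1_comp _ expR (fun y => - a * y) s _ _ _ h.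
  by move=> /(_ _ (is_derive_expR _))/is_derive_eq; apply; rewrite mulr1 mulrC.
have [c c01 e] := mvt01 t01 Hg.
have {e} gle : g t <= g 0.
  rewrite -subr_le0 e mulr_le0_ge0 //; last by case/andP: t01.
  have -> : dg c = expR (- a * c) * (df c - (a * f c + b)) by rewrite /dg; field.
  by rewrite mulr_ge0_le0 ?expR_ge0 // subr_le0 dfle.
have ba : b / a <= b by rewrite ler_pdivrMr ?ler_peMr // (lt_le_trans _ a1).
have ba0 : 0 <= b / a by rewrite divr_ge0 // (le_trans _ a1).
move: gle; rewrite /g mulr0 expR0 mulr1 mulNr expRN ler_pdivrMr ?expR_gt0 // => h.
apply: (@le_trans _ _ ((f 0 + b / a) * expR (a * t))).
  by apply: le_trans h; rewrite lerDl.
apply: ler_pM; rewrite ?addr_ge0 ?expR_ge0 ?lerD2l //.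
rewrite ler_expR; case/andP: t01 => t0 t1.
by rewrite ler_piMr // (le_trans _ a1).
Qed.

End RealCalculus.

(** * Liouville's theorem through difference quotients *)

Section SumOfSquares.
Variables (R : realType) (n : nat).
Implicit Types v w : 'rV[R]_n.

Definition sumsq v : R := \sum_i v 0 i ^+ 2.

Lemma sumsq_ge0 v : 0 <= sumsq v.
Proof. by apply: sumr_ge0 => i _; rewrite sqr_ge0. Qed.

Lemma mx_l1_row v : mx_l1 v = \sum_i `|v 0 i|.
Proof. by rewrite /mx_l1 big_ord1. Qed.

Lemma dot_le_mx_l1 v w : `|\sum_i v 0 i * w 0 i| <= mx_l1 v * mx_l1 w.
Proof.
rewrite (le_trans (ler_norm_sum _ _ _)) // mx_l1_row mulr_suml ler_sum // => i _.
by rewrite normrM ler_wpM2l // entry_le_mx_l1.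
Qed.

Lemma sumsq_le v : sumsq v <= mx_l1 v ^+ 2.
Proof.
rewrite expr2; apply: le_trans (dot_le_mx_l1 v v); by rewrite (le_trans _ (ler_norm _)).
Qed.

Lemma mx_l1_sq_le v : mx_l1 v ^+ 2 <= n%:R * sumsq v.
Proof.
rewrite expr2 {1}mx_l1_row mulr_suml.
under eq_bigr do rewrite mx_l1_row mulr_sumr.
apply: (@le_trans _ _ (\sum_i \sum_j (v 0 i ^+ 2 / 2 + v 0 j ^+ 2 / 2))).
  apply: ler_sum => i _; apply: ler_sum => j _.
  rewrite -[v 0 i ^+ 2]real_normK ?num_real // -[v 0 j ^+ 2]real_normK ?num_real //.
  by have := sqr_ge0 (`|v 0 i| - `|v 0 j|); nra.
rewrite (eq_bigr (fun i => n%:R * (v 0 i ^+ 2 / 2) + sumsq v / 2)); last first.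
  by move=> i _; rewrite big_split /= sumr_const card_ord mulr_natl -mulr_suml.
rewrite big_split /= sumr_const card_ord -mulr_sumr -mulr_suml -/(sumsq v) -mulr_natl.
lra.
Qed.

End SumOfSquares.

(** * Dependence of solutions on the initial value *)

Section Liouville.
Variables (R : realType) (n : nat).
Variables (M : 'rV[R]_n -> Prop) (X : 'rV[R]_n -> 'rV[R]_n) (A : 'rV[R]_n -> 'M[R]_n).
Variable T : R.

(** Only the base point [y] is bounded; [y'] ranges over all of [M], and [A] is tested only on
    differences of points of [M], so that [M] need not be open. *)
Definition first_order_expansion := forall b : R, exists2 L, 0 <= L &
  forall y y', M y -> M y' -> mx_l1 y <= b ->
    mx_l1 (A y) <= L /\
    mx_l1 (X y' - X y - (y' - y) *m A y) <= L * mx_l1 (y' - y) ^+ 2.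

(** Time is rescaled to the unit interval: a trajectory followed up to time [T], of either sign, is
    reparametrized by s T. *)
Definition solution (z : R -> 'rV[R]_n) := forall s : R, 0 <= s <= 1 ->
  M (z s) /\ forall i, is_derive s 1 (fun s => z s 0 i) (T * X (z s) 0 i).

Hypothesis expansion : first_order_expansion.

Lemma coord_bounded (z dz : R -> 'rV[R]_n) :
  (forall s : R, 0 <= s <= 1 -> forall i, is_derive s 1 (fun s => z s 0 i) (dz s 0 i)) ->
  exists2 b, 0 <= b & forall s : R, 0 <= s <= 1 -> mx_l1 (z s) <= b.
Proof.
move=> hz.
have /all_sig[b hb] i : {b : R | 0 <= b & forall s : R, 0 <= s <= 1 -> `|z s 0 i| <= b}.
  by apply: cid2; apply: (@derive_bounded _ _ (fun s => dz s 0 i)) => s s01; apply: hz.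
exists (\sum_i b i); first by apply: sumr_ge0 => i _; case: (hb i).
by move=> s s01; rewrite mx_l1_row ler_sum // => i _; case: (hb i) => _; apply.
Qed.

Lemma solution_bounded z : solution z ->
  exists2 b, 0 <= b & forall s : R, 0 <= s <= 1 -> mx_l1 (z s) <= b.
Proof.
move=> hz; apply: (@coord_bounded _ (fun s => T *: X (z s))) => s s01 i.
by rewrite mxE; apply: (hz s s01).2.
Qed.

Lemma is_derive_sumsq (v : R -> 'rV[R]_n) (dv : 'rV[R]_n) (s : R) :
  (forall i, is_derive s 1 (fun s => v s 0 i) (dv 0 i)) ->
  is_derive s 1 (fun s => sumsq (v s)) (2 * \sum_i v s 0 i * dv 0 i).
Proof.
move=> H; rewrite mulr_sumr; apply: is_derive1_sum => i.
apply: is_derive_eq (is_derive1M (H i) (H i)) _; ring.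
Qed.

(* With r = |z' - z|^2 one has r' <= c r (1 + r); the bounded quantity r / (1 + r)
   then satisfies a linear differential inequality, so that no a priori bound on z'
   is needed. *)
Lemma solution_lipschitz z : solution z ->
  exists2 L, 0 <= L & exists2 eta, 0 < eta & forall z', solution z' ->
    mx_l1 (z' 0 - z 0) <= eta ->
    forall s : R, 0 <= s <= 1 -> mx_l1 (z' s - z s) <= L * mx_l1 (z' 0 - z 0).
Proof.
move=> hz; have [b _ hb] := solution_bounded hz; have [L L0 hL] := expansion b.
pose N : R := n%:R; have N0 : 0 <= N by rewrite ler0n.
(* The powers of [N] come from comparing the l1 norm with the sum of squares. Below, c + 1 serves as
   the rate, because [gronwall] needs a rate of at least 1. *)
pose c := 2 * `|T| * L * (2 * N + N ^+ 2).
have c0 : 0 <= c by rewrite !mulr_ge0 ?addr_ge0 ?mulr_ge0 ?sqr_ge0.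
pose E := expR (c + 1); have E0 : 0 < E by exact: expR_gt0.
pose K := 2 * N * E; have K0 : 0 <= K by rewrite !mulr_ge0 // ltW.
(* K bounds the ratio of squares; K <= (K + 1)^2 spares a square root. *)
exists (K + 1); first by rewrite addr_ge0.
(* With q0 the initial distance, both bounds together give q0^2 E <= 1/2, hence r / (1 + r) <= 1/2,
   and then r is at most twice this quotient. *)
exists (Num.min 1 (1 / (2 * E))).
  by rewrite lt_min ltr01 divr_gt0 ?mulr_gt0.
move=> z' hz' heta s s01.
pose D := fun s => z' s - z s.
pose r := fun s => sumsq (D s).
pose dD := fun s => T *: (X (z' s) - X (z s)).
pose dr := fun s => 2 * \sum_i D s 0 i * dD s 0 i.
have hr (u : R) : 0 <= u <= 1 -> is_derive u 1 r (dr u).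
  move=> u01; apply: is_derive_sumsq => i.
  have e : (fun s => D s 0 i) = (fun s => z' s 0 i - z s 0 i).
    by apply/funext => w; rewrite !mxE.
  rewrite e; have -> : dD u 0 i = T * X (z' u) 0 i - T * X (z u) 0 i by rewrite !mxE mulrBr.
  by apply: is_derive1B; [apply: (hz' u u01).2|apply: (hz u u01).2].
have rge0 (u : R) : 0 <= r u by exact: sumsq_ge0.
have drle (u : R) : 0 <= u <= 1 -> dr u <= c * (r u * (1 + r u)).
  move=> u01; have [hA hrem] := hL _ _ (hz u u01).1 (hz' u u01).1 (hb u u01).
  set q := mx_l1 (D u).
  have q0 : 0 <= q by exact: mx_l1_ge0.
  have hdD : mx_l1 (dD u) <= `|T| * (L * q + L * q ^+ 2).
    rewrite mx_l1Z ler_wpM2l // -(subrK (D u *m A (z u)) (_ - _)) addrC.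
    rewrite (le_trans (mx_l1D _ _)) // lerD // (le_trans (mx_l1M _ _)) // mulrC.
    by rewrite ler_wpM2r.
  have hq : q ^+ 2 <= N * r u by exact: mx_l1_sq_le.
  have h1 : dr u <= 2 * (q * mx_l1 (dD u)).
    by rewrite /dr ler_pM2l // (le_trans (ler_norm _)) // dot_le_mx_l1.
  have h2 : q * mx_l1 (dD u) <= `|T| * L * (q ^+ 2 + q ^+ 3).
    rewrite (le_trans (ler_wpM2l q0 hdD)) // le_eqVlt; apply/orP; left; apply/eqP; ring.
  have h3 : q ^+ 2 + q ^+ 3 <= (2 * N + N ^+ 2) * (r u * (1 + r u)).
    have h4 : q ^+ 3 <= q ^+ 2 + (q ^+ 2) ^+ 2.
      have -> : q ^+ 3 = q ^+ 2 * q by ring.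
      have -> : q ^+ 2 + (q ^+ 2) ^+ 2 = q ^+ 2 * (1 + q ^+ 2) by ring.
      by rewrite ler_wpM2l ?sqr_ge0 //; have := sqr_ge0 (q - 1); nra.
    have h5 : (q ^+ 2) ^+ 2 <= (N * r u) ^+ 2.
      by rewrite ler_pXn2r // ?nnegrE ?sqr_ge0 // mulr_ge0.
    have h6 : 0 <= N * r u ^+ 2 by rewrite mulr_ge0 ?sqr_ge0.
    have h7 : 0 <= N ^+ 2 * r u by rewrite mulr_ge0 ?sqr_ge0.
    by have := rge0 u; nra.
  rewrite (le_trans h1) // /c -!mulrA ler_pM2l //; apply: le_trans h2 _.
  by rewrite -mulrA ler_wpM2l // ler_wpM2l.
pose h := fun u => 1 - (1 + r u)^-1.
pose dh := fun u => (1 + r u) ^- 2 * dr u.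
have r1 (u : R) : 1 + r u != 0 by rewrite gt_eqF // ltr_wpDr.
have hh (u : R) : 0 <= u <= 1 -> is_derive u 1 h (dh u).
  move=> u01.
  have h1 : is_derive u 1 (fun u => 1 + r u) (dr u).
    by rewrite -[dr u]add0r; exact: is_derive1D (is_derive_cst (1 : R) u 1) (hr u u01).
  have h2 : is_derive u 1 (fun u => (1 + r u)^-1) (- (1 + r u) ^- 2 * dr u).
    apply: DeriveDef; first by apply: derivableV => //; case: h1.
    by rewrite deriveV //; case: h1 => // _ ->.
  rewrite (_ : dh u = 0 - (- (1 + r u) ^- 2 * dr u)); last by rewrite /dh; ring.
  exact: is_derive1B (is_derive_cst (1 : R) u 1) h2.
have hE (u : R) : h u = r u / (1 + r u) by rewrite /h; field.
have h_le (u : R) : h u <= r u.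
  by rewrite hE ler_pdivrMr ?ltr_wpDr // ler_peMr // lerDl.
have hge0 (u : R) : 0 <= h u by rewrite hE divr_ge0 // addr_ge0.
have dhle (u : R) : 0 <= u <= 1 -> dh u <= (c + 1) * h u + 0.
  move=> u01; rewrite addr0 (@le_trans _ _ (c * h u)) //; last first.
    by rewrite ler_wpM2r // lerDl.
  rewrite /dh hE mulrC ler_pdivrMr ?exprn_gt0 ?ltr_wpDr //.
  rewrite (le_trans (drle u u01)) // le_eqVlt; apply/orP; left; apply/eqP; field.
  exact: r1.
have := gronwall (_ : 1 <= c + 1) (lexx 0) (hge0 0) hh dhle s01.
rewrite lerDr => /(_ c0); rewrite addr0 => hs.
set q0 := mx_l1 (z' 0 - z 0) in heta *.
have q00 : 0 <= q0 by exact: mx_l1_ge0.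
have [q01 q02] : q0 <= 1 /\ q0 * (2 * E) <= 1.
  move: heta; rewrite le_min => /andP[-> /=].
  by rewrite ler_pdivlMr // mulr_gt0.
have rq0 : r 0 <= q0 ^+ 2 by exact: sumsq_le.
have hs2 : h s <= q0 ^+ 2 * E.
  by rewrite (le_trans hs) // ler_wpM2r ?(ltW E0) // (le_trans (h_le _)).
have hhalf : h s <= 1 / 2 by rewrite (le_trans hs2) //; nra.
have rs : r s <= 2 * h s.
  move: hhalf; rewrite hE; have r1s : 0 < 1 + r s by rewrite ltr_wpDr.
  rewrite ler_pdivrMr // => h1; rewrite mulrA ler_pdivlMr //; have := rge0 s; nra.
have hfin : mx_l1 (z' s - z s) ^+ 2 <= ((K + 1) * q0) ^+ 2.
  apply: (le_trans (mx_l1_sq_le _)); rewrite -/N -/(D s) -/(r s).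
  apply: (@le_trans _ _ (K * q0 ^+ 2)).
    by rewrite /K; have : N * r s <= N * (2 * (q0 ^+ 2 * E)); [rewrite ler_wpM2l //; lra|lra].
  by rewrite exprMn ler_wpM2r ?sqr_ge0 //; nra.
rewrite -(ler_pXn2r (n := 2)) // nnegrE ?mx_l1_ge0 // mulr_ge0 // addr_ge0 //.
Qed.

(* Two difference quotients of the flow satisfy the same linearized equation up to
   errors of the order of the increments. *)
Lemma quotient_stability z (k : R) : solution z -> 0 <= k ->
  exists2 L, 0 <= L & forall z1 z2 (a1 a2 : R), solution z1 -> solution z2 ->
    a1 != 0 -> a2 != 0 ->
    (forall s : R, 0 <= s <= 1 -> mx_l1 (z1 s - z s) <= k * `|a1|) ->
    (forall s : R, 0 <= s <= 1 -> mx_l1 (z2 s - z s) <= k * `|a2|) ->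
    mx_l1 (a1^-1 *: (z1 1 - z 1) - a2^-1 *: (z2 1 - z 1)) <=
    L * (mx_l1 (a1^-1 *: (z1 0 - z 0) - a2^-1 *: (z2 0 - z 0)) + (`|a1| + `|a2|)).
Proof.
move=> hz k0; have [b _ hb] := solution_bounded hz; have [L L0 hL] := expansion b.
pose N : R := n%:R; have N0 : 0 <= N by rewrite ler0n.
pose m := L * k ^+ 2; have m0 : 0 <= m by rewrite mulr_ge0 ?sqr_ge0.
(* The 1 added to 2 L comes from 2 q (m sg) <= q^2 + (m sg)^2, whose second square accounts for
   [b']; the last 1 is for [gronwall]. *)
pose a := `|T| * (2 * L + 1) * N + 1.
have aa : 0 <= `|T| * (2 * L + 1) * N by rewrite !mulr_ge0 // addr_ge0 // mulr_ge0.
pose b' := `|T| * m ^+ 2; have b'0 : 0 <= b' by rewrite mulr_ge0 ?sqr_ge0.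
pose E := expR a; have E0 : 0 < E by exact: expR_gt0.
pose K := N * (1 + b') * E; have K0 : 0 <= K by rewrite !mulr_ge0 ?addr_ge0 // ltW.
exists (K + 1); first by rewrite addr_ge0.
move=> z1 z2 a1 a2 h1 h2 a10 a20 q1 q2.
pose e := fun s => a1^-1 *: (z1 s - z s) - a2^-1 *: (z2 s - z s).
pose de := fun s => T *: (a1^-1 *: (X (z1 s) - X (z s)) - a2^-1 *: (X (z2 s) - X (z s))).
pose sg := `|a1| + `|a2|; have sg0 : 0 <= sg by rewrite addr_ge0.
pose r := fun s => sumsq (e s).
pose dr := fun s => 2 * \sum_i e s 0 i * de s 0 i.
have hr (u : R) : 0 <= u <= 1 -> is_derive u 1 r (dr u).
  move=> u01; apply: is_derive_sumsq => i.
  have -> : (fun s => e s 0 i) = (fun s => a1^-1 * (z1 s 0 i - z s 0 i) - a2^-1 * (z2 s 0 i - z s 0 i)).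
    by apply/funext => w; rewrite !mxE.
  have -> : de u 0 i = a1^-1 * (T * X (z1 u) 0 i - T * X (z u) 0 i)
                     - a2^-1 * (T * X (z2 u) 0 i - T * X (z u) 0 i).
    by rewrite !mxE; ring.
  by apply: is_derive1B; apply: is_derive1Z; apply: is_derive1B;
    [apply: (h1 u u01).2|apply: (hz u u01).2|apply: (h2 u u01).2|apply: (hz u u01).2].
have rem z' (a' u : R) : solution z' -> a' != 0 -> 0 <= u <= 1 ->
    mx_l1 (z' u - z u) <= k * `|a'| ->
    mx_l1 (a'^-1 *: (X (z' u) - X (z u) - (z' u - z u) *m A (z u))) <= m * `|a'|.
  move=> hz' a'0 u01 hk; have [_ hrem] := hL _ _ (hz u u01).1 (hz' u u01).1 (hb u u01).
  have a'p : 0 < `|a'| by rewrite normr_gt0.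
  rewrite mx_l1Z normfV ler_pdivrMl //.
  apply: (le_trans hrem).
  rewrite (_ : `|a'| * (m * `|a'|) = L * (k * `|a'|) ^+ 2); last by rewrite /m; ring.
  by rewrite ler_wpM2l // ler_pXn2r // ?nnegrE ?mx_l1_ge0 // mulr_ge0.
have drle (u : R) : 0 <= u <= 1 -> dr u <= a * r u + b' * sg ^+ 2.
  move=> u01; set q := mx_l1 (e u).
  have qq0 : 0 <= q by exact: mx_l1_ge0.
  have [hA _] := hL _ _ (hz u u01).1 (hz u u01).1 (hb u u01).
  have hde : mx_l1 (de u) <= `|T| * (L * q + m * sg).
    rewrite mx_l1Z ler_wpM2l //.
    rewrite (_ : _ - _ = e u *m A (z u) +
       (a1^-1 *: (X (z1 u) - X (z u) - (z1 u - z u) *m A (z u)) -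
        a2^-1 *: (X (z2 u) - X (z u) - (z2 u - z u) *m A (z u)))); last first.
      rewrite /e mulmxBl -!scalemxAl ![_ *: (_ - _ *m _)]scalerBr opprB.
      move: (a1^-1 *: (_ *m _)) (a2^-1 *: (_ *m _)) => p1 p2.
      move: (a1^-1 *: _) (a2^-1 *: _) => p3 p4.
      by apply/rowP => i; rewrite !mxE; ring.
    rewrite (le_trans (mx_l1D _ _)) // lerD //.
      by rewrite (le_trans (mx_l1M _ _)) // mulrC ler_wpM2r.
    rewrite (le_trans (mx_l1D _ _)) // mx_l1N mulrDr lerD //.
      by apply: rem => //; exact: q1.
    by apply: rem => //; exact: q2.
  have hq : q ^+ 2 <= N * r u by exact: mx_l1_sq_le.
  have h3 : dr u <= 2 * (q * mx_l1 (de u)).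
    by rewrite /dr ler_pM2l // (le_trans (ler_norm _)) // dot_le_mx_l1.
  have h4 : q * mx_l1 (de u) <= q * (`|T| * (L * q + m * sg)) by rewrite ler_wpM2l.
  have h5 : 2 * (q * (`|T| * (L * q + m * sg))) <= `|T| * ((2 * L + 1) * q ^+ 2 + m ^+ 2 * sg ^+ 2).
    have -> : 2 * (q * (`|T| * (L * q + m * sg))) = `|T| * (2 * L * q ^+ 2 + 2 * (q * (m * sg))) by ring.
    rewrite ler_wpM2l //; have := sqr_ge0 (q - m * sg); nra.
  have h6 : `|T| * (2 * L + 1) * q ^+ 2 <= `|T| * (2 * L + 1) * (N * r u).
    by rewrite ler_wpM2l // mulr_ge0 // addr_ge0 // mulr_ge0.
  have := sumsq_ge0 (e u); rewrite -/(r u) => ru.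
  rewrite /a /b'; nra.
have := gronwall (_ : 1 <= a) (_ : 0 <= b' * sg ^+ 2) (sumsq_ge0 _) hr drle (_ : 0 <= (1 : R) <= 1).
rewrite /a lerDr ler01 lexx => /(_ aa).
move=> /(_ _ isT); rewrite mulr_ge0 ?sqr_ge0 // => /(_ isT) hs.
rewrite -/(e 1) -/(e 0) -/sg.
have e0 : 0 <= mx_l1 (e 0) by exact: mx_l1_ge0.
have hfin : mx_l1 (e 1) ^+ 2 <= ((K + 1) * (mx_l1 (e 0) + sg)) ^+ 2.
  apply: (le_trans (mx_l1_sq_le _)); rewrite -/N.
  apply: (@le_trans _ _ (K * (mx_l1 (e 0) + sg) ^+ 2)).
    rewrite /K -!mulrA ler_wpM2l // (le_trans hs) // mulrCA mulrC -/E.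
    rewrite [X in _ <= X]mulrC -[X in _ <= X]mulrA ler_wpM2l ?(ltW E0) //.
    have := sumsq_le (e 0); have := mulr_ge0 e0 sg0; have := sqr_ge0 (mx_l1 (e 0)).
    rewrite -/(r 0); nra.
  by rewrite exprMn ler_wpM2r ?sqr_ge0 //; nra.
rewrite -(ler_pXn2r (n := 2)) // nnegrE ?mx_l1_ge0 // mulr_ge0 // addr_ge0 //.
Qed.

Definition quotient (Z : R -> R -> 'rV[R]_n) (h s : R) : 'rV[R]_n :=
  h^-1 *: (Z h s - Z 0 s).

Lemma near_mx_l1 (F : set_system R) {FF : Filter F} (f : R -> 'rV[R]_n) (l : 'rV[R]_n) :
  (forall i, f h 0 i @[h --> F] --> l 0 i) ->
  forall e : R, 0 < e -> \forall h \near F, mx_l1 (f h - l) <= e.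
Proof.
move=> hf e e0; pose c := e / (n%:R + 1).
have n1 : 0 < n%:R + 1 :> R by rewrite ltr_wpDl.
have c0 : 0 < c by rewrite divr_gt0.
have : \forall h \near F, forall i, `|l 0 i - f h 0 i| <= c.
  by apply: filter_forall => i; move/cvgrPdist_le : (hf i); apply.
apply: filterS => h H; rewrite mx_l1_row.
apply: (@le_trans _ _ (\sum_(i < n) c)).
  by apply: ler_sum => i _; rewrite !mxE distrC.
rewrite sumr_const card_ord -mulr_natl /c mulrA ler_pdivrMr // mulrC ler_wpM2l //.
  exact: ltW.
by rewrite lerDl.
Qed.

Lemma quotient_cvg (Z : R -> R -> 'rV[R]_n) (s : R) (u : 'rV[R]_n) :
  (forall i, is_derive (0 : R) 1 (fun h => Z h s 0 i) (u 0 i)) ->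
  forall i, quotient Z h s 0 i @[h --> 0^'] --> u 0 i.
Proof.
move=> H i; have [dZ e] := H i; rewrite -e.
apply: cvg_trans dZ; apply: near_eq_cvg; near=> h.
by rewrite /= !mxE addr0 [h *: 1]mulr1.
Unshelve. all: by end_near. Qed.

Lemma cvg_quotient (Z : R -> R -> 'rV[R]_n) (s : R) (w : 'rV[R]_n) :
  (forall i, quotient Z h s 0 i @[h --> 0^'] --> w 0 i) ->
  forall i, is_derive (0 : R) 1 (fun h => Z h s 0 i) (w 0 i).
Proof.
move=> H i.
have H' : (fun h : R => h^-1 *: ((fun h => Z h s 0 i) (h *: 1 + 0) - Z 0 s 0 i)) @ 0^' --> w 0 i.
  apply: cvg_trans (H i); apply: near_eq_cvg; near=> h.
  by rewrite /= !mxE addr0 [h *: 1]mulr1.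
by apply: DeriveDef; [apply/cvg_ex; exists (w 0 i)|apply: cvg_lim].
Unshelve. all: by end_near. Qed.

Section Variation.
Variables (Z : R -> R -> 'rV[R]_n) (u : 'rV[R]_n).
Hypothesis Zsol : \forall h \near (0 : R), solution (Z h).
Hypothesis Zder : forall i, is_derive (0 : R) 1 (fun h => Z h 0 0 i) (u 0 i).

Let Z0 : solution (Z 0). Proof. exact: (nbhs_singleton Zsol). Qed.

(** At time 0 the quotients converge to [u], so the initial distance is at most (|u| + 1) |h|, which
    for small h is below the threshold of [solution_lipschitz]. *)
Lemma variation_bounded : exists2 k : R, 0 <= k &
  \forall h \near 0^', forall s : R, 0 <= s <= 1 -> mx_l1 (Z h s - Z 0 s) <= k * `|h|.
Proof.
have [L L0 [eta eta0 hL]] := solution_lipschitz Z0.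
pose c := mx_l1 u + 1; have c0 : 0 < c by rewrite ltr_wpDl ?mx_l1_ge0.
exists (L * c); first by rewrite mulr_ge0 // ltW.
near=> h.
have h0 : h != 0 by near: h; exact: nbhs_dnbhs_neq.
have hs : solution (Z h) by near: h; apply: nbhs_dnbhs.
have hc : mx_l1 (quotient Z h 0) <= c.
  rewrite -(subrK u (quotient Z h 0)) (le_trans (mx_l1D _ _)) // addrC lerD2l.
  by near: h; apply: near_mx_l1 => //; exact: quotient_cvg.
have hi : mx_l1 (Z h 0 - Z 0 0) <= c * `|h|.
  move: hc; rewrite /quotient mx_l1Z normfV ler_pdivrMl ?normr_gt0 //.
  by rewrite mulrC.
move=> s s01; rewrite -mulrA; apply: le_trans (hL _ hs _ _ s01) _.
  apply: (le_trans hi); rewrite -ler_pdivlMl //.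
  by near: h; apply: dnbhs0_le; rewrite mulr_gt0 ?invr_gt0.
by rewrite ler_wpM2l.
Unshelve. all: by end_near. Qed.

(** [quotient_stability] carries the Cauchy property of the quotients from time 0 to time 1, and
    completeness of R provides the limit. *)
Lemma variation_derivable : exists w : 'rV[R]_n,
  forall i, is_derive (0 : R) 1 (fun h => Z h 1 0 i) (w 0 i).
Proof.
have [k k0 hk] := variation_bounded.
have [L L0 hL] := quotient_stability Z0 k0.
have hd := quotient_cvg Zder.
suff H i : cvg (quotient Z h 1 0 i @[h --> 0^']).
  exists (\row_i lim (quotient Z h 1 0 i @[h --> 0^'])).
  by apply: cvg_quotient => i; rewrite mxE; exact: H.
apply: cauchy_cvg; apply: cauchy_exP => e e0.
(* Four quantities are kept below c: the distances of the two initial quotients to [u] and the two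
   increments; so 4 L c < e is what is needed. *)
pose c := e / (4 * L + 1).
have L1 : 0 < 4 * L + 1 by rewrite ltr_wpDl // mulr_ge0.
have c0 : 0 < c by rewrite divr_gt0.
pose good (h : R) := [/\ h != 0, solution (Z h), `|h| <= c, mx_l1 (quotient Z h 0 - u) <= c &
    forall s : R, 0 <= s <= 1 -> mx_l1 (Z h s - Z 0 s) <= k * `|h|].
have hgood : \forall h \near 0^', good h.
  near=> h; split.
  - by near: h; exact: nbhs_dnbhs_neq.
  - by near: h; apply: nbhs_dnbhs.
  - by near: h; apply: dnbhs0_le.
  - by near: h; apply: near_mx_l1.
  - by near: h.
near (0 : R)^' => a.
have [a0 sa ac ua ka] : good a by near: a.
have hg := hgood.
exists (quotient Z a 1 0 i); apply: filterS hg => b [b0 sb bc ub kb].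
rewrite /ball /=.
have -> : quotient Z a 1 0 i - quotient Z b 1 0 i = (quotient Z a 1 - quotient Z b 1) 0 i.
  by rewrite !mxE.
rewrite (le_lt_trans (entry_le_mx_l1 _ _ _)) // (le_lt_trans (hL _ _ _ _ sa sb a0 b0 ka kb)) //.
rewrite -/(quotient Z a 0) -/(quotient Z b 0).
have : mx_l1 (quotient Z a 0 - quotient Z b 0) <= c + c.
  rewrite -[quotient Z a 0 - _](subrKA u).
  by rewrite (le_trans (mx_l1D _ _)) // lerD // -mx_l1N opprB.
move=> hab.
apply: (@le_lt_trans _ _ (L * (4 * c))).
  by rewrite ler_wpM2l //; lra.
have -> : e = (4 * L + 1) * c by rewrite /c; field; rewrite gt_eqF.
nra.
Unshelve. all: by end_near. Qed.

End Variation.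

End Liouville.

(** * Transport of the weighted volume *)

Section VolumeForm.
Variables (R : realType) (k : nat).
Local Notation n := (1 + k)%N.

Lemma cvg_big_sum (I : Type) (r : seq I) (F : set_system R) {FF : Filter F}
    (f : I -> R -> R) (l : I -> R) :
  (forall i, f i h @[h --> F] --> l i) ->
  \sum_(i <- r) f i h @[h --> F] --> \sum_(i <- r) l i.
Proof.
move=> H; elim: r => [|i r IH].
  by rewrite big_nil; under eq_fun do rewrite big_nil; exact: cvg_cst.
by rewrite big_cons; under eq_fun do rewrite big_cons; exact: cvgD.
Qed.

Lemma cvg_big_prod (I : Type) (r : seq I) (F : set_system R) {FF : Filter F}
    (f : I -> R -> R) (l : I -> R) :
  (forall i, f i h @[h --> F] --> l i) ->
  \prod_(i <- r) f i h @[h --> F] --> \prod_(i <- r) l i.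
Proof.
move=> H; elim: r => [|i r IH].
  by rewrite big_nil; under eq_fun do rewrite big_nil; exact: cvg_cst.
by rewrite big_cons; under eq_fun do rewrite big_cons; exact: cvgM.
Qed.

Lemma cvg_det m (F : set_system R) {FF : Filter F} (V : R -> 'M[R]_m) (L : 'M[R]_m) :
  (forall i j, V h i j @[h --> F] --> L i j) -> \det (V h) @[h --> F] --> \det L.
Proof.
move=> H; rewrite /determinant; apply: cvg_big_sum => s.
by apply: cvgM; [exact: cvg_cst|apply: cvg_big_prod].
Qed.

Variables (M : 'rV[R]_n -> Prop) (X : 'rV[R]_n -> 'rV[R]_n) (A : 'rV[R]_n -> 'M[R]_n).
Variable T : R.
Hypothesis expansion : first_order_expansion M X A.
Variables (Z : 'I_k -> R -> R -> 'rV[R]_n) (z : R -> 'rV[R]_n) (u w : 'I_k -> 'rV[R]_n).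
Variables (nu : R -> 'rV[R]_n) (rho : R -> R).
Hypothesis Z0 : forall j, Z j 0 = z.
Hypothesis hz : solution M X T z.
Hypothesis Zsol : forall j, \forall h \near (0 : R), solution M X T (Z j h).
Hypothesis Zu : forall j i, is_derive (0 : R) 1 (fun h => Z j h 0 0 i) (u j 0 i).
Hypothesis Zw : forall j i, is_derive (0 : R) 1 (fun h => Z j h 1 0 i) (w j 0 i).
Hypothesis hnu : forall s : R, 0 <= s <= 1 -> forall i,
  is_derive s 1 (fun s => nu s 0 i) (T * (nu s *m A (z s)) 0 i).
Hypothesis hrho : forall s : R, 0 <= s <= 1 ->
  is_derive s 1 rho (- (T * \tr (A (z s)) * rho s)).

(* By Jacobi's formula and hrho, the derivative of rho * det V is controlled by the
   error of the linearized equation alone. *)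
Let V h s : 'M[R]_n := col_mx (nu s) (\matrix_j quotient (Z j) h s).

Lemma col_mx_matrixE (v : 'rV[R]_n) (q : 'I_k -> 'rV[R]_n) i j :
  col_mx v (\matrix_j q j) i j =
  match fintype.split i with inl _ => v 0 j | inr l => q l 0 j end.
Proof. by rewrite mxE; case: (fintype.split i) => a; rewrite ?ord1 ?mxE. Qed.

Lemma volume_almost_invariant : exists2 K : R, 0 <= K &
  \forall h \near 0^', `|rho 1 * \det (V h 1) - rho 0 * \det (V h 0)| <= K * `|h|.
Proof.
have [b _ hb] := solution_bounded hz; have [L L0 hL] := expansion b.
have /all_sig2[K K0 hK] j : {c : R | 0 <= c &
    \forall h \near 0^', forall s : R, 0 <= s <= 1 -> mx_l1 (Z j h s - z s) <= c * `|h|}.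
  by apply: cid2; rewrite -(Z0 j); apply: (variation_bounded expansion (Zsol j) (Zu j)).
have [br br0 hbr] := derive_bounded hrho.
have [bn bn0 hbn] : exists2 c, 0 <= c & forall s : R, 0 <= s <= 1 -> mx_l1 (nu s) <= c.
  apply: (@coord_bounded _ _ nu (fun s => T *: (nu s *m A (z s)))) => s s01 i.
  by rewrite mxE; exact: hnu.
(* The argument bounds the l1 norm of [V h s] uniformly in s and in small h. *)
have [La La0 hLa] := adj_bounded n (bn + \sum_j K j).
pose Ce := \sum_j `|T| * (L * K j ^+ 2).
have Ce0 : 0 <= Ce by apply: sumr_ge0 => j _; rewrite !mulr_ge0 ?sqr_ge0.
exists (br * (Ce * La)); first by rewrite !mulr_ge0.
near=> h.
have h0 : h != 0 by near: h; exact: nbhs_dnbhs_neq.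
have hp : 0 < `|h| by rewrite normr_gt0.
have hs : forall j, solution M X T (Z j h).
  by near: h; apply: filter_forall => j; apply: nbhs_dnbhs; exact: Zsol.
have hq : forall j, forall s : R, 0 <= s <= 1 -> mx_l1 (Z j h s - z s) <= K j * `|h|.
  by near: h; apply: filter_forall.
have qE j s : quotient (Z j) h s = h^-1 *: (Z j h s - z s) by rewrite /quotient Z0.
(* The first row vanishes because [nu] solves the linearized equation exactly; the others are a
   quadratic remainder divided by h, hence O(h). *)
pose Err s : 'M[R]_n := col_mx 0 (\matrix_j
  (T *: (h^-1 *: (X (Z j h s) - X (z s) - (Z j h s - z s) *m A (z s))))).
have VA s : V h s *m A (z s) = col_mx (nu s *m A (z s)) (\matrix_j (quotient (Z j) h s *m A (z s))).
  rewrite mul_col_mx; congr col_mx; apply/row_matrixP => j.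
  by rewrite row_mul !rowK.
have dV (s : R) : 0 <= s <= 1 -> forall i j,
    is_derive s 1 (fun s => V h s i j) ((T *: (V h s *m A (z s)) + Err s) i j).
  move=> s01 i j; have -> : (T *: (V h s *m A (z s)) + Err s) i j =
      T * (V h s *m A (z s)) i j + Err s i j by rewrite mxE [X in X + _]mxE.
  have -> : (fun s => V h s i j) = (fun s => match fintype.split i with
      inl _ => nu s 0 j | inr l => quotient (Z l) h s 0 j end).
    by apply/funext => v; rewrite /V col_mx_matrixE.
  rewrite VA /Err.
  rewrite !col_mx_matrixE; case: (fintype.split i) => l.
    by rewrite !mxE addr0; have := hnu s01 j; rewrite mxE.
  have -> : (fun s => quotient (Z l) h s 0 j) = (fun s => h^-1 * (Z l h s 0 j - z s 0 j)).
    by apply/funext => v; rewrite qE !mxE.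
  have -> : T * (quotient (Z l) h s *m A (z s)) 0 j +
      (T *: (h^-1 *: (X (Z l h s) - X (z s) - (Z l h s - z s) *m A (z s)))) 0 j =
      h^-1 * (T * X (Z l h s) 0 j - T * X (z s) 0 j).
    by rewrite qE -scalemxAl; move: (_ *m A (z s)) => B; rewrite !mxE; ring.
  by apply: is_derive1Z; apply: is_derive1B; [apply: (hs l s s01).2|apply: (hz s01).2].
pose G s := rho s * \det (V h s).
have dG (s : R) : 0 <= s <= 1 -> is_derive s 1 G (rho s * \tr (Err s *m \adj (V h s))).
  move=> s01; have h1 := is_derive1M (hrho s01) (is_derive1_det (dV s s01)).
  apply: is_derive_eq h1 _.
  rewrite mulmxDl mxtraceD -scalemxAl mxtraceZ mxtrace_mulC mulmxA mul_adj_mx.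
  by rewrite mul_scalar_mx mxtraceZ; ring.
have o1 : 0 <= (1 : R) <= 1 by rewrite ler01 lexx.
have [c c01] := mvt01 o1 dG.
rewrite -/(G 1) -/(G 0) => ->; rewrite mulr1 normrM -mulrA.
apply: ler_pM => //; first exact: hbr.
rewrite (le_trans (trace_le _)) // (le_trans (mx_l1M _ _)) //.
have hErr : mx_l1 (Err c) <= Ce * `|h|.
  rewrite mx_l1_col_mx mx_l1_0 add0r /mx_l1 mulr_suml ler_sum // => j _.
  rewrite (eq_bigr (fun i => `|(T *: (h^-1 *: (X (Z j h c) - X (z c)
       - (Z j h c - z c) *m A (z c)))) 0 i|)); last by move=> i _; rewrite mxE.
  rewrite -mx_l1_row !mx_l1Z -mulrA ler_wpM2l // normfV ler_pdivrMl //.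
  have [_ hr] := hL _ _ (hz c01).1 (hs j c c01).1 (hb c c01).
  apply: (le_trans hr); rewrite (_ : `|h| * (L * K j ^+ 2 * `|h|) = L * (K j * `|h|) ^+ 2); last by ring.
  by rewrite ler_wpM2l // ler_pXn2r ?nnegrE ?mx_l1_ge0 ?mulr_ge0 // hq.
rewrite mulrAC; apply: ler_pM; rewrite ?mx_l1_ge0 //.
apply: hLa; rewrite mx_l1_col_mx lerD ?hbn // /mx_l1 ler_sum // => j _.
rewrite (eq_bigr (fun i => `|quotient (Z j) h c 0 i|)); last by move=> i _; rewrite mxE.
by rewrite -mx_l1_row qE mx_l1Z normfV ler_pdivrMl // mulrC hq.
Unshelve. all: by end_near. Qed.

(** Both determinants of quotients converge to determinants of derivatives, while their weighted
    difference is O(h). *)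
Lemma volume_invariant :
  rho 1 * \det (col_mx (nu 1) (\matrix_j w j)) = rho 0 * \det (col_mx (nu 0) (\matrix_j u j)).
Proof.
have [K K0 hK] := volume_almost_invariant.
apply/eqP; rewrite -subr_eq0; apply/eqP.
have cV s (v : 'I_k -> 'rV[R]_n) : (forall j i, is_derive (0 : R) 1 (fun h => Z j h s 0 i) (v j 0 i)) ->
    \det (V h s) @[h --> 0^'] --> \det (col_mx (nu s) (\matrix_j v j)).
  move=> H; apply: cvg_det => i j; rewrite col_mx_matrixE.
  under eq_fun do rewrite col_mx_matrixE.
  by case: (fintype.split i) => l; [exact: cvg_cst|exact: quotient_cvg].
have c1 : rho 1 * \det (V h 1) - rho 0 * \det (V h 0) @[h --> 0^'] -->
    rho 1 * \det (col_mx (nu 1) (\matrix_j w j)) - rho 0 * \det (col_mx (nu 0) (\matrix_j u j)).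
  by apply: cvgB; apply: cvgM; do ?[exact: cvg_cst]; apply: cV.
apply: (cvg_unique _ c1) => //; apply/cvgrPdist_le => e e0.
near=> h; rewrite sub0r normrN.
have /le_trans -> // : `|rho 1 * \det (V h 1) - rho 0 * \det (V h 0)| <= K * `|h| by near: h.
apply: (@le_trans _ _ ((K + 1) * `|h|)); first by rewrite ler_wpM2r // lerDl.
rewrite -ler_pdivlMl ?ltr_wpDl //; near: h; apply: dnbhs0_le.
by rewrite mulr_gt0 // invr_gt0 ltr_wpDl.
Unshelve. all: by end_near. Qed.

End VolumeForm.

(** * The rolling vector field and its divergence *)

Section Rolling.
Variables (R : realType) (n : nat).
Local Notation K := #|@upper_pairs n|.
Implicit Types (g u : 'rV[R]_n.+1) (x y : 'rV[R]_K) (J : 'M[R]_K).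

Definition unit_row g := (g *m g^T) 0 0 = 1.

Definition pr_mx g : 'M[R]_K := (wedge_mx g)^T *m wedge_mx g.

Definition coercive J (D : R) := forall x, D * (x *m x^T) 0 0 <= (x *m J *m x^T) 0 0.

(* Matrix of the map sending omega to m = pr_v (I omega) + pr_h omega. *)
Definition momentum_mx J g : 'M[R]_K := 1%:M + (J - 1%:M) *m pr_mx g.

Lemma pr_mx_sym g : (pr_mx g)^T = pr_mx g.
Proof. by rewrite /pr_mx trmx_mul trmxK. Qed.

Lemma pr_mx_idem g : unit_row g -> pr_mx g *m pr_mx g = pr_mx g.
Proof.
move=> g1; rewrite /pr_mx mulmxA -[_ *m _ *m (wedge_mx g)^T]mulmxA wedge_mx_tr_mul g1.
rewrite scale1r mulmxBr mulmx1 mulmxBl -[X in _ - X]mulmxA -[g^T *m g *m _]mulmxA.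
by rewrite mulmx_wedge_mx_self !mulmx0 subr0.
Qed.

Lemma sumsqE m (v : 'rV[R]_m) : sumsq v = (v *m v^T) 0 0.
Proof. by rewrite mxE; apply: eq_bigr => i _; rewrite mxE expr2. Qed.

Lemma unit_row_le g : unit_row g -> mx_l1 g <= n.+1%:R.
Proof.
move=> g1; rewrite mx_l1_row; apply: (@le_trans _ _ (\sum_(i < n.+1) 1)); last first.
  by rewrite sumr_const card_ord.
apply: ler_sum => i _; rewrite -(ler_pXn2r (n := 2)) ?nnegrE // expr1n real_normK ?num_real //.
rewrite -[leRHS]g1 -sumsqE /sumsq (bigD1 i) //= lerDl.
by apply: sumr_ge0 => j _; rewrite sqr_ge0.
Qed.

(** From m = x B one reads off m (1 - P) = x (1 - P), so only v = x P is unknown. It satisfies v J P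
    = m P - m (1 - P) J P, and pairing with v = v P gives D |v|^2 on the left by coercivity. The
    constant does not depend on g, so this yields both invertibility of B and a uniform bound on its
    inverse. *)
Lemma momentum_mx_coercive J D : 0 < D -> coercive J D -> exists2 L, 0 <= L &
  forall g x, unit_row g -> mx_l1 x <= L * mx_l1 (x *m momentum_mx J g).
Proof.
move=> D0 hJ.
have [p p0 hp] : bounded_by unit_row (fun=> 1) pr_mx.
  have hg : bounded_by unit_row (fun=> 1) (fun g : 'rV[R]_n.+1 => g).
    by exists n.+1%:R => // g g1; rewrite mulr1 unit_row_le.
  have hW := bounded_by_lin (@wedge_mx R n) hg.
  exact: bounded_byMl (bounded_by_tr hW) hW.
pose j := mx_l1 J; pose i1 := mx_l1 (1%:M : 'M[R]_K).
have j0 : 0 <= j by exact: mx_l1_ge0.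
have i10 : 0 <= i1 by exact: mx_l1_ge0.
pose N : R := K%:R; have N0 : 0 <= N by rewrite ler0n.
pose c := p + (i1 + p) * j * p; have c0 : 0 <= c by rewrite addr_ge0 // !mulr_ge0 // addr_ge0.
exists (N / D * c + (i1 + p)); first by rewrite !addr_ge0 // !mulr_ge0 // invr_ge0 ltW.
move=> g x g1; set P := pr_mx g; set m := x *m _.
have PP : P *m P = P := pr_mx_idem g1.
have hP : mx_l1 P <= p by have := hp g g1; rewrite mulr1.
have h1P : mx_l1 (1%:M - P) <= i1 + p.
  by rewrite (le_trans (mx_l1D _ _)) // mx_l1N lerD2l.
have mE : m = x + x *m J *m P - x *m P.
  by rewrite /m /momentum_mx -/P mulmxDr mulmx1 mulmxBl mul1mx mulmxBr !mulmxA addrA.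
have mP : m *m P = x *m J *m P.
  rewrite mE mulmxBl mulmxDl -[x *m J *m P *m P]mulmxA -[x *m P *m P]mulmxA PP.
  by rewrite addrAC subrr add0r.
have m1P : m *m (1%:M - P) = x *m (1%:M - P).
  by rewrite mulmxBr mulmx1 mP mE mulmxBr mulmx1 addrAC addrK.
pose v := x *m P; pose a := m *m P - m *m (1%:M - P) *m J *m P.
have vJ : v *m J *m P = a.
  by rewrite /a mP m1P /v mulmxBr mulmx1 !mulmxBl opprB addrC subrK.
have vv : v = v *m P by rewrite /v -mulmxA PP.
have hv : D * sumsq v <= mx_l1 a * mx_l1 v.
  rewrite sumsqE (le_trans (hJ v)) // {2}vv trmx_mul pr_mx_sym mulmxA vJ mxE.
  rewrite (le_trans (ler_norm _)) //.
  rewrite (eq_bigr (fun i => a 0 i * v 0 i)) ?dot_le_mx_l1 // => i _.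
  by rewrite [v^T _ _]mxE.
have a0 : 0 <= mx_l1 a by exact: mx_l1_ge0.
have m0 : 0 <= mx_l1 m by exact: mx_l1_ge0.
have ha : mx_l1 a <= c * mx_l1 m.
  rewrite (le_trans (mx_l1D _ _)) // mx_l1N /c mulrDl lerD //.
    by rewrite (le_trans (mx_l1M _ _)) // mulrC ler_wpM2r.
  have h1 : mx_l1 (m *m (1%:M - P)) <= mx_l1 m * (i1 + p).
    by rewrite (le_trans (mx_l1M _ _)) // ler_wpM2l.
  have h2 : mx_l1 (m *m (1%:M - P) *m J) <= mx_l1 m * (i1 + p) * j.
    by rewrite (le_trans (mx_l1M _ _)) // ler_wpM2r.
  rewrite (_ : _ * mx_l1 m = mx_l1 m * (i1 + p) * j * p); last by ring.
  by rewrite (le_trans (mx_l1M _ _)) // ler_pM ?mx_l1_ge0.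
have hv2 : mx_l1 v <= N / D * mx_l1 a.
  have v0 : 0 <= mx_l1 v by exact: mx_l1_ge0.
  have := mx_l1_sq_le v; rewrite -/N => h1.
  have h2 : D * mx_l1 v ^+ 2 <= N * (mx_l1 a * mx_l1 v).
    rewrite (@le_trans _ _ (D * (N * sumsq v))) ?ler_wpM2l ?(ltW D0) //.
    by rewrite mulrCA ler_wpM2l.
  rewrite mulrAC ler_pdivlMr // mulrC.
  have [->|vn0] := eqVneq (mx_l1 v) 0; first by rewrite mulr0 mulr_ge0.
  have vp : 0 < mx_l1 v by rewrite lt_neqAle eq_sym vn0.
  by rewrite -(ler_pM2r vp) -mulrA -expr2 -mulrA.
have -> : x = v + m *m (1%:M - P) by rewrite m1P mulmxBr mulmx1 addrC subrK.
rewrite (le_trans (mx_l1D _ _)) // mulrDl lerD //.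
  by rewrite (le_trans hv2) // -[N / D * c * _]mulrA ler_wpM2l // divr_ge0 // ltW.
by rewrite (le_trans (mx_l1M _ _)) // mulrC ler_wpM2r.
Qed.

Lemma momentum_mx_unit J D g : 0 < D -> coercive J D -> unit_row g ->
  momentum_mx J g \in unitmx.
Proof.
move=> D0 hJ g1; have [L L0 hL] := momentum_mx_coercive D0 hJ.
rewrite -row_free_unit -kermx_eq0; apply/eqP/row_matrixP => k; rewrite row0.
have : row k (kermx (momentum_mx J g)) *m momentum_mx J g = 0.
  by rewrite -row_mul mulmx_ker row0.
move: (row k _) => x hx; have := hL g x g1; rewrite hx mx_l1_0 mulr0 => x0.
apply/rowP => i; apply/eqP; rewrite mxE -normr_le0.
exact: le_trans (entry_le_mx_l1 _ _ _) x0.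
Qed.

Lemma inv_momentum_mx_bounded J D : 0 < D -> coercive J D ->
  bounded_by unit_row (fun=> 1) (fun g => invmx (momentum_mx J g)).
Proof.
move=> D0 hJ; have [L L0 hL] := momentum_mx_coercive D0 hJ.
exists (\sum_(k < K) L * mx_l1 ('e_k : 'rV[R]_K)).
  by apply: sumr_ge0 => k _; rewrite mulr_ge0 ?mx_l1_ge0.
move=> g g1; rewrite mulr1 {1}/mx_l1 ler_sum // => k _.
rewrite (eq_bigr (fun i => `|row k (invmx (momentum_mx J g)) 0 i|)) -?mx_l1_row; last first.
  by move=> i _; rewrite mxE.
rewrite (le_trans (hL g _ g1)) // rowE -mulmxA mulVmx ?mulmx1 //.
exact: (momentum_mx_unit D0 hJ g1).
Qed.

Lemma coercive_homotopy J D (s : R) : coercive J D -> 0 <= s <= 1 ->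
  coercive (1%:M + s *: (J - 1%:M)) (Num.min 1 D).
Proof.
move=> hJ /andP[s0 s1] x; have := hJ x.
have -> : (x *m (1%:M + s *: (J - 1%:M)) *m x^T) 0 0 =
          (1 - s) * (x *m x^T) 0 0 + s * (x *m J *m x^T) 0 0.
  rewrite mulmxDr mulmx1 mulmxDl -scalemxAr -scalemxAl mulmxBr mulmxBl mulmx1.
  by move: (x *m x^T) (x *m J *m x^T) => a b; rewrite !mxE; ring.
have : 0 <= (x *m x^T) 0 0 by rewrite -sumsqE sumsq_ge0.
move: ((x *m x^T) 0 0) ((x *m J *m x^T) 0 0) => a b a0 h.
have h1 : Num.min 1 D * a <= a by rewrite -[leRHS]mul1r ler_wpM2r // ge_min lexx.
have h2 : Num.min 1 D * a <= b by apply: le_trans h; rewrite ler_wpM2r // ge_min lexx orbT.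
nra.
Qed.

Lemma horner_det_pencil m (B : 'M[R]_m) (s : R) :
  (\det (1%:M + 'X *: map_mx polyC B)).[s] = \det (1%:M + s *: B).
Proof.
rewrite -horner_evalE -det_map_mx; congr (\det _); apply/matrixP => i j.
by rewrite !mxE /= /horner_eval; case: (i == j); rewrite !hornerE.
Qed.

(* The segment from 1 to J stays coercive, so the determinant keeps its sign. *)
Lemma det_momentum_mx_gt0 J D g : 0 < D -> coercive J D -> unit_row g ->
  0 < \det (momentum_mx J g).
Proof.
move=> D0 hJ g1; pose Q := (J - 1%:M) *m pr_mx g.
pose q : {poly R} := \det (1%:M + 'X *: map_mx polyC Q).
have qE (s : R) : q.[s] = \det (1%:M + s *: Q) by exact: horner_det_pencil.
have qn0 (s : R) : 0 <= s <= 1 -> q.[s] != 0.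
  move=> s01; have := momentum_mx_unit _ (coercive_homotopy hJ s01) g1.
  rewrite lt_min ltr01 D0 => /(_ isT).
  by rewrite unitmxE unitfE qE /momentum_mx addrAC subrr add0r -scalemxAl.
have q0 : q.[0] = 1 by rewrite qE scale0r addr0 det1.
have q1 : q.[1] = \det (momentum_mx J g) by rewrite qE scale1r.
rewrite -q1 ltNge; apply/negP => hle.
have [|s] := @poly_ivt _ (- q) 0 1 ler01.
  by rewrite !hornerN q0 oppr_ge0 hle andbT oppr_le0 ler01.
move=> s01; rewrite rootE hornerN oppr_eq0.
by apply/negP/qn0.
Qed.

Variables (J : 'M[R]_K) (D eps : R).
Hypotheses (Jsym : J^T = J) (D0 : 0 < D) (Jcoer : coercive J D).
Local Notation N := (n.+1 + K)%N.
Implicit Types z : 'rV[R]_N.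

Definition unit_phase z := unit_row (lsubmx z).
Local Notation gam := (@lsubmx R 1 n.+1 K).
Local Notation mom := (@rsubmx R 1 n.+1 K).
Local Notation W z := (wedge_mx (gam z)).
Local Notation P z := (pr_mx (gam z)).
Local Notation Q := (J - 1%:M).

Definition resolvent z := invmx (momentum_mx J (gam z)).
Local Notation C := resolvent.
Definition ang_vel z : 'rV[R]_K := mom z *m C z.
Local Notation om := ang_vel.

Definition gyro z : 'rV[R]_K := om z *m ad_mx (om z *m J).

Definition rolling_field z : 'rV[R]_N :=
  row_mx (- eps *: (om z *m (W z)^T))
         (eps *: (om z *m ad_mx (mom z)) + (1 - eps) *: (gyro z *m P z)).

(* Velocity of x P(g) when g moves with velocity u, in the form u * twist x. The
   radial part of u does not contribute, which amounts to extending the projection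
   off the sphere as a function homogeneous of degree 0. *)
Definition twist z x : 'M[R]_(n.+1, K) :=
  W z *m (ad_mx x *m P z - ad_mx (x *m P z)).

(** Differentiating omega B(g) = m at fixed m: the variation of omega under a velocity u of g is
    minus u times this matrix. *)
Definition dang_vel_g z := twist z (om z *m Q) *m C z.
Local Notation E := dang_vel_g.

(** It acts on row increments from the right: the block rows differentiate with respect to g and m,
    the block columns yield the velocities of g and m. *)
Definition jacobian z : 'M[R]_N := block_mx
  (- eps *: (- (E z *m (W z)^T) - so_of (om z)))
  (- eps *: (E z *m ad_mx (mom z))
     + (1 - eps) *: (- (E z *m (ad_mx (om z *m J) - J *m ad_mx (om z)) *m P z)
                     + twist z (gyro z)))
  (- eps *: (C z *m (W z)^T))
  (eps *: (- ad_mx (om z) + C z *m ad_mx (mom z))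
   + (1 - eps) *: ((- (C z *m (J *m ad_mx (om z))) + C z *m ad_mx (om z *m J)) *m P z)).

Lemma momentumK z : unit_phase z -> om z *m momentum_mx J (gam z) = mom z.
Proof. by move=> z1; rewrite -mulmxA mulVmx ?mulmx1 // (momentum_mx_unit D0). Qed.

Lemma momentum_resolvent z : unit_phase z -> momentum_mx J (gam z) *m C z = 1%:M.
Proof. by move=> z1; rewrite mulmxV // (momentum_mx_unit D0). Qed.

Lemma Qsym : Q^T = Q.
Proof. by rewrite linearB /= Jsym trmx1. Qed.

(** It rewrites the second [ad_mx] in the twist of omega Q as ad m - ad omega, which brings the
    trace to the shape of [mxtrace_rolling]. *)
Lemma omQP z : unit_phase z -> om z *m Q *m P z = mom z - om z.
Proof.
move=> z1; rewrite -(momentumK z1) /momentum_mx mulmxDr mulmx1 mulmxA.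
by rewrite addrAC subrr add0r.
Qed.

Lemma trace_jacobian z : unit_phase z ->
  \tr (jacobian z) = - (1 - eps *+ 2) * \tr (C z *m ad_mx (om z)).
Proof.
move=> z1; rewrite mxtrace_block.
have J1 : J = 1%:M + Q by rewrite addrC subrK.
rewrite /dang_vel_g /twist (omQP z1) [ad_mx (_ - _)]linearB /= {2}J1.
apply: mxtrace_rolling => //; rewrite ?ad_mx_skew ?pr_mx_sym ?Qsym //.
- exact: pr_mx_idem.
- exact: momentum_resolvent.
- exact: so_of_so.
Qed.

Lemma twist_radial z x : gam z *m twist z x = 0.
Proof. by rewrite mulmxA mulmx_wedge_mx_self mul0mx. Qed.

(** In the radial direction omega and P are constant, so only the linear factor g in the velocity -
    eps omega g is differentiated, and this returns that velocity. *)
Lemma jacobian_radial z :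
  row_mx (gam z) (0 : 'rV[R]_K) *m jacobian z =
  row_mx (lsubmx (rolling_field z)) 0.
Proof.
have E0 : gam z *m E z = 0 by rewrite mulmxA twist_radial mul0mx.
rewrite mul_row_block !mul0mx !addr0 row_mxKl; congr row_mx.
  rewrite -scalemxAr mulmxBr mulmxN mulmxA E0 mul0mx oppr0 sub0r.
  by rewrite so_coords_tr_wedge.
have h (B : 'M[R]_K) : gam z *m (E z *m B) = 0 by rewrite mulmxA E0 mul0mx.
rewrite mulmxDr -!scalemxAr h mulmxDr mulmxN -[E z *m _ *m P z]mulmxA h twist_radial.
by rewrite oppr0 addr0 !scaler0 addr0.
Qed.

End Rolling.

(** * First-order expansion of the vector field *)

Section ExpansionAlgebra.
Variables (R : realFieldType) (n k : nat).

(** Here G and H are [wedge_mx] of g and of its increment. The term with S cancels against its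
    transpose by skewness, leaving the commutator of the Gram matrix with A. *)
Lemma gram_expand (G H : 'M[R]_(n, k)) (A : 'M[R]_k) (S : 'M[R]_n) (l c : R) :
  A^T = - A -> S^T = - S -> H = G *m A + S *m G + l *: G -> c = - (l *+ 2) ->
  H^T *m (G + H) + G^T *m H =
  G^T *m G *m A - A *m (G^T *m G) + (H^T *m H - c *: (G^T *m G)).
Proof.
move=> hA hS hH ->; rewrite mulmxDr.
have -> : H^T *m G = - (A *m (G^T *m G)) - G^T *m (S *m G) + l *: (G^T *m G).
  rewrite hH !linearD /= linearZ /= !trmx_mul hA hS !mulmxDl !mulNmx mulmxN -scalemxAl.
  by rewrite mulNmx !mulmxA.
have -> : G^T *m H = G^T *m G *m A + G^T *m (S *m G) + l *: (G^T *m G).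
  by rewrite hH !mulmxDr -scalemxAr !mulmxA.
move: (G^T *m G) (H^T *m H) (G^T *m (S *m G)) (G^T *m G *m A) (A *m (G^T *m G)).
move=> A1 A2 A3 A4 A5.
by apply/matrixP => i j; rewrite !mxE; ring.
Qed.

(** The linear part m C - u E of the increment of omega is factored out; the next identity does the
    same for the velocity of m. *)
Lemma jacobian_row_g (u : 'rV[R]_n) (m : 'rV[R]_k) (E : 'M[R]_(n, k)) (V : 'M[R]_(k, n))
    (S : 'M[R]_n) (C : 'M[R]_k) (e : R) :
  u *m (- e *: (- (E *m V) - S)) + m *m (- e *: (C *m V)) =
  - e *: ((m *m C - u *m E) *m V - u *m S).
Proof.
rewrite -!scalemxAr !mulmxDr !mulmxDl !mulmxN !mulNmx !mulmxA.
move: (u *m E *m V) (m *m C *m V) (u *m S) => A1 A2 A3.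
by apply/rowP => i; rewrite !mxE; ring.
Qed.

Lemma jacobian_row_m (u : 'rV[R]_n) (m : 'rV[R]_k) (E F : 'M[R]_(n, k))
    (Am Aw AI C I P : 'M[R]_k) (e : R) :
  u *m (- e *: (E *m Am) + (1 - e) *: (- (E *m (AI - I *m Aw) *m P) + F))
  + m *m (e *: (- Aw + C *m Am) + (1 - e) *: ((- (C *m (I *m Aw)) + C *m AI) *m P)) =
  e *: ((m *m C - u *m E) *m Am - m *m Aw)
  + (1 - e) *: (((m *m C - u *m E) *m AI - (m *m C - u *m E) *m I *m Aw) *m P + u *m F).
Proof.
rewrite !mulmxDr -!scalemxAr !(mulmxDr, mulmxDl, mulmxN, mulNmx, mulmxA).
move: (u *m E *m Am) (m *m Aw) (m *m C *m Am) (u *m F) (u *m E *m AI *m P)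
  (m *m C *m AI *m P) (u *m E *m I *m Aw *m P) (m *m C *m I *m Aw *m P).
by move=> A1 A2 A3 A4 A5 A6 A7 A8; apply/rowP => i; rewrite !mxE; ring.
Qed.

Lemma quadratic_expand (ad : {linear 'rV[R]_k -> 'M[R]_k}) (w d l r : 'rV[R]_k) (I : 'M[R]_k) :
  d = l + r ->
  (w + d) *m ad ((w + d) *m I) - w *m ad (w *m I) =
  l *m ad (w *m I) + w *m ad (l *m I)
  + (r *m ad (w *m I) + w *m ad (r *m I) + d *m ad (d *m I)).
Proof.
move=> h.
rewrite (mulmxDl w d I) linearD /= mulmxDl [w *m (_ + _)]mulmxDr [d *m (_ + _)]mulmxDr.
have -> : d *m ad (w *m I) = l *m ad (w *m I) + r *m ad (w *m I) by rewrite h mulmxDl.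
have -> : w *m ad (d *m I) = w *m ad (l *m I) + w *m ad (r *m I).
  by rewrite h mulmxDl linearD /= mulmxDr.
move: (w *m ad (w *m I)) (d *m _) (l *m _) (r *m _) (w *m ad (l *m I)) (w *m ad (r *m I)).
by move=> A1 A2 A3 A4 A5 A6; apply/rowP => i; rewrite !mxE; ring.
Qed.

Variables (x y m1 m2 : 'rV[R]_k) (Q P1 P2 C1 C2 L r : 'M[R]_k).
Hypotheses (hx : x *m (1%:M + Q *m P1) = m1) (hy : y *m (1%:M + Q *m P2) = m2).
Hypotheses (hC1 : (1%:M + Q *m P1) *m C1 = 1%:M) (hC2 : (1%:M + Q *m P2) *m C2 = 1%:M).

(** This exact form of the resolvent identity shows that y - x is of first order. Fed into the
    quadratic term (y - x) Q (P2 - P1) of [resolvent_expand], it makes the remainder there of second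
    order. *)
Lemma resolvent_incr : y - x = (m2 - m1 - x *m Q *m (P2 - P1)) *m C2.
Proof.
rewrite -[LHS]mulmx1 -hC2 mulmxA; congr (_ *m _).
rewrite mulmxBl hy -hx mulmxBr !mulmxDr !mulmx1 !mulmxA.
move: (x *m Q *m P2) (x *m Q *m P1) => A1 A2.
by apply/rowP => i; rewrite !mxE; ring.
Qed.

Lemma resolvent_expand : P2 - P1 = L + r ->
  y - x = (m2 - m1 - x *m Q *m L) *m C1
        - (x *m Q *m r + (y - x) *m Q *m (P2 - P1)) *m C1.
Proof.
move=> hP; rewrite -mulmxBl -[LHS]mulmx1 -hC1 mulmxA; congr (_ *m _).
have -> : x *m Q *m r = x *m Q *m (P2 - P1) - x *m Q *m L by rewrite hP mulmxDr addrC addKr.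
rewrite -hx -hy !mulmxDr !mulmxDl !mulmxN !mulNmx !mulmx1 !mulmxA.
move: (x *m Q *m P2) (x *m Q *m P1) (y *m Q *m P2) (y *m Q *m P1) (_ *m L) => A1 A2 A3 A4 A5.
by apply/rowP => i; rewrite !mxE; ring.
Qed.

End ExpansionAlgebra.

(** * Uniform bounds for increments and remainders *)

Section Expansion.
Variables (R : realType) (n : nat).
Local Notation K := #|@upper_pairs n|.
Local Notation N := (n.+1 + K)%N.
Variables (J : 'M[R]_K) (D eps b : R).
Hypotheses (D0 : 0 < D) (Jcoer : coercive J D).
Local Notation gam := (@lsubmx R 1 n.+1 K).
Local Notation mom := (@rsubmx R 1 n.+1 K).
Local Notation W z := (wedge_mx (gam z)).
Local Notation P z := (pr_mx (gam z)).
Local Notation C := (resolvent J).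
Local Notation om := (ang_vel J).
Local Notation gyr := (gyro J).
Local Notation Q := (J - 1%:M).
Local Notation pair := ('rV[R]_N * 'rV[R]_N)%type.
Implicit Types (t : pair).

(** The second point is constrained only in its g-component: its momentum enters the remainders
    through increments alone. *)
Definition increment_dom t := [/\ unit_phase t.1, unit_phase t.2 & mx_l1 t.1 <= b].
Definition increment t : R := mx_l1 (t.2 - t.1).
Definition increment_sq t : R := increment t ^+ 2.
Local Notation O := (bounded_by increment_dom).

Lemma mx_l1_lsubmx (z : 'rV[R]_N) : mx_l1 (gam z) <= mx_l1 z.
Proof. by rewrite -{2}(hsubmxK z) mx_l1_row_mx lerDl mx_l1_ge0. Qed.

Lemma mx_l1_rsubmx (z : 'rV[R]_N) : mx_l1 (mom z) <= mx_l1 z.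
Proof. by rewrite -{2}(hsubmxK z) mx_l1_row_mx lerDr mx_l1_ge0. Qed.

Lemma bounded_by_scale m p e1 e2 (s : pair -> 'M[R]_1) (f : pair -> 'M[R]_(m, p)) :
  O e1 s -> O e2 f -> O (fun t => e1 t * e2 t) (fun t => s t 0 0 *: f t).
Proof.
move=> [L L0 hL] [L' L'0 hL']; exists (L * L'); first exact: mulr_ge0.
move=> t Dt; rewrite mx_l1Z mulrACA; apply: ler_pM; rewrite ?mx_l1_ge0 ?hL' //.
exact: le_trans (entry_le_mx_l1 _ _ _) (hL t Dt).
Qed.

Definition incr_g t := gam t.2 - gam t.1.
Definition incr_m t := mom t.2 - mom t.1.
Definition incr_P t := P t.2 - P t.1.
Definition incr_om t := om t.2 - om t.1.
Definition lin_P t := P t.1 *m ad_mx (incr_g t *m W t.1) - ad_mx (incr_g t *m W t.1) *m P t.1.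
Definition rem_P t := pr_mx (incr_g t) - (incr_g t *m (incr_g t)^T) 0 0 *: P t.1.
Definition lin_om t := (incr_m t - om t.1 *m Q *m lin_P t) *m C t.1.
Definition rem_om t := - ((om t.1 *m Q *m rem_P t + incr_om t *m Q *m incr_P t) *m C t.1).

Lemma wedge_mx_incr t : W t.2 = W t.1 + wedge_mx (incr_g t).
Proof. by rewrite -linearD /= addrC subrK. Qed.

Lemma pr_mx_incr t : incr_P t = (wedge_mx (incr_g t))^T *m W t.2 + (W t.1)^T *m wedge_mx (incr_g t).
Proof.
rewrite /incr_P /pr_mx wedge_mx_incr; move: (wedge_mx (incr_g t)) (W t.1) => H G.
rewrite [(G + H)^T]linearD /= !mulmxDl !mulmxDr.
move: (G^T *m G) (G^T *m H) (H^T *m G) (H^T *m H) => A1 A2 A3 A4.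
by apply/matrixP => i j; rewrite !mxE; ring.
Qed.

(** Both g and g + u have length 1, so 2 (u, g) = - |u|^2; the radial term of [wedge_mx_unit]
    therefore joins the remainder. *)
Lemma pr_mx_expand t : increment_dom t -> incr_P t = lin_P t + rem_P t.
Proof.
move=> [z1 z2 _]; rewrite pr_mx_incr wedge_mx_incr.
apply: (gram_expand (ad_mx_skew _) (so_of_so _) (wedge_mx_unit (incr_g t) z1)).
have : unit_row (gam t.1 + incr_g t) by rewrite /incr_g addrC subrK.
rewrite /unit_row linearD /= mulmxDl !mulmxDr.
have -> : gam t.1 *m (incr_g t)^T = (incr_g t *m (gam t.1)^T)^T by rewrite trmx_mul trmxK.
have : (gam t.1 *m (gam t.1)^T) 0 0 = 1 by exact: z1.
move: (gam t.1 *m _) (incr_g t *m (gam t.1)^T) (incr_g t *m (incr_g t)^T) => A B E hA.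
by rewrite !mxE; lra.
Qed.

Lemma ang_vel_incr t : increment_dom t ->
  incr_om t = (incr_m t - om t.1 *m Q *m incr_P t) *m C t.2.
Proof.
move=> [z1 z2 _].
apply: (@resolvent_incr _ _ (om t.1) (om t.2) (mom t.1) (mom t.2) Q (P t.1) (P t.2)).
- exact: (momentumK D0 Jcoer z1).
- exact: (momentumK D0 Jcoer z2).
- exact: (momentum_resolvent D0 Jcoer z2).
Qed.

Lemma ang_vel_expand t : increment_dom t -> incr_om t = lin_om t + rem_om t.
Proof.
move=> Dt; have [z1 z2 _] := Dt.
apply: (@resolvent_expand _ _ (om t.1) (om t.2) (mom t.1) (mom t.2) Q (P t.1) (P t.2) _
  (lin_P t) (rem_P t)).
- exact: (momentumK D0 Jcoer z1).
- exact: (momentumK D0 Jcoer z2).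
- exact: (momentum_resolvent D0 Jcoer z1).
- exact: (pr_mx_expand Dt).
Qed.

Local Notation O1 := (O (fun=> 1)).

Lemma O_incr_g : O increment incr_g.
Proof.
exists 1 => // t _; rewrite mul1r /incr_g -linearB /=; exact: mx_l1_lsubmx.
Qed.

Lemma O_incr_m : O increment incr_m.
Proof.
exists 1 => // t _; rewrite mul1r /incr_m -linearB /=; exact: mx_l1_rsubmx.
Qed.

Lemma O_mom : O1 (fun t => mom t.1).
Proof.
exists (Num.max b 0); first by rewrite le_max lexx orbT.
move=> t [_ _ tb]; rewrite mulr1 le_max; apply/orP; left.
exact: le_trans (mx_l1_rsubmx _) tb.
Qed.

Lemma O_W1 : O1 (fun t => W t.1).
Proof.
apply: bounded_by_lin; exists n.+1%:R => // t [z1 _ _].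
by rewrite mulr1 unit_row_le.
Qed.

Lemma O_W2 : O1 (fun t => W t.2).
Proof.
apply: bounded_by_lin; exists n.+1%:R => // t [_ z2 _].
by rewrite mulr1 unit_row_le.
Qed.

Lemma O_P1 : O1 (fun t => P t.1).
Proof. exact: bounded_byMl (bounded_by_tr O_W1) O_W1. Qed.

Lemma O_P2 : O1 (fun t => P t.2).
Proof. exact: bounded_byMl (bounded_by_tr O_W2) O_W2. Qed.

Lemma O_C1 : O1 (fun t => C t.1).
Proof.
have [L L0 hL] := inv_momentum_mx_bounded D0 Jcoer; exists L => // t [z1 _ _].
exact: hL.
Qed.

Lemma O_C2 : O1 (fun t => C t.2).
Proof.
have [L L0 hL] := inv_momentum_mx_bounded D0 Jcoer; exists L => // t [_ z2 _].
exact: hL.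
Qed.

Lemma O_om : O1 (fun t => om t.1).
Proof. exact: bounded_byMl O_mom O_C1. Qed.

Lemma O_cst m p (A : 'M[R]_(m, p)) : O1 (fun=> A).
Proof. exact: bounded_by_cst. Qed.

Lemma O_ad e (x : pair -> 'rV[R]_K) : O e x -> O e (fun t => ad_mx (x t)).
Proof. exact: bounded_by_lin. Qed.

Lemma O_gyro : O1 (fun t => gyr t.1).
Proof. exact: bounded_byMl O_om (O_ad (bounded_byMl O_om (O_cst J))). Qed.

Lemma O_sq m p q (f : pair -> 'M[R]_(m, p)) (g : pair -> 'M[R]_(p, q)) :
  O increment f -> O increment g -> O increment_sq (fun t => f t *m g t).
Proof. by apply: bounded_byM => t _; rewrite /increment_sq expr2. Qed.

Lemma O_lin_P : O increment lin_P.
Proof.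
have h := O_ad (bounded_byMl O_incr_g O_W1).
by apply: bounded_byB; [exact: bounded_byMr O_P1 h|exact: bounded_byMl h O_P1].
Qed.

Lemma O_rem_P : O increment_sq rem_P.
Proof.
have h := bounded_by_lin (@wedge_mx R n) O_incr_g.
apply: bounded_byB; first exact: O_sq (bounded_by_tr h) h.
apply: (bounded_byW _ (bounded_by_scale (O_sq O_incr_g (bounded_by_tr O_incr_g)) O_P1)).
by move=> t _; rewrite mulr1.
Qed.

Lemma O_incr_P : O increment incr_P.
Proof.
have h := bounded_by_lin (@wedge_mx R n) O_incr_g.
apply: (bounded_by_ext (fun t _ => esym (pr_mx_incr t))); apply: bounded_byD.
  exact: bounded_byMl (bounded_by_tr h) O_W2.
exact: bounded_byMr (bounded_by_tr O_W1) h.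
Qed.

Lemma O_incr_om : O increment incr_om.
Proof.
apply: (bounded_by_ext (fun t Dt => esym (ang_vel_incr Dt))).
apply: bounded_byMl O_C2; apply: bounded_byB; first exact: O_incr_m.
exact: bounded_byMr (bounded_byMl O_om (O_cst Q)) O_incr_P.
Qed.

Lemma O_lin_om : O increment lin_om.
Proof.
apply: bounded_byMl O_C1; apply: bounded_byB; first exact: O_incr_m.
exact: bounded_byMr (bounded_byMl O_om (O_cst Q)) O_lin_P.
Qed.

Lemma O_rem_om : O increment_sq rem_om.
Proof.
apply: bounded_byN; apply: bounded_byMl O_C1; apply: bounded_byD.
  exact: bounded_byMr (bounded_byMl O_om (O_cst Q)) O_rem_P.
exact: O_sq (bounded_byMl O_incr_om (O_cst Q)) O_incr_P.
Qed.

Definition lin_gyr t := lin_om t *m ad_mx (om t.1 *m J) + om t.1 *m ad_mx (lin_om t *m J).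
Definition rem_gyr t := rem_om t *m ad_mx (om t.1 *m J) + om t.1 *m ad_mx (rem_om t *m J)
  + incr_om t *m ad_mx (incr_om t *m J).

Lemma gyro_expand t : increment_dom t -> gyr t.2 - gyr t.1 = lin_gyr t + rem_gyr t.
Proof.
move=> Dt; have e : om t.2 = om t.1 + incr_om t by rewrite /incr_om addrC subrK.
rewrite /gyro e /rem_gyr /lin_gyr.
exact: (quadratic_expand (@ad_mx R n) (om t.1) J (ang_vel_expand Dt)).
Qed.

Lemma O_lin_gyr : O increment lin_gyr.
Proof.
apply: bounded_byD; first exact: bounded_byMl O_lin_om (O_ad (bounded_byMl O_om (O_cst J))).
exact: bounded_byMr O_om (O_ad (bounded_byMl O_lin_om (O_cst J))).
Qed.

Lemma O_rem_gyr : O increment_sq rem_gyr.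
Proof.
apply: bounded_byD; last exact: O_sq O_incr_om (O_ad (bounded_byMl O_incr_om (O_cst J))).
apply: bounded_byD; first exact: bounded_byMl O_rem_om (O_ad (bounded_byMl O_om (O_cst J))).
exact: bounded_byMr O_om (O_ad (bounded_byMl O_rem_om (O_cst J))).
Qed.

Lemma mul_lin_P x t : x *m lin_P t = incr_g t *m twist t.1 x.
Proof.
rewrite /lin_P /twist mulmxBr !mulmxA ad_mx_anti (ad_mx_anti x) !mulNmx.
by rewrite [in RHS]mulmxBr !mulmxA opprK addrC.
Qed.

Lemma lin_omE t : lin_om t = incr_m t *m C t.1 - incr_g t *m dang_vel_g J t.1.
Proof. by rewrite /lin_om mulmxBl mul_lin_P /dang_vel_g mulmxA. Qed.

Lemma jacobian_apply t : (t.2 - t.1) *m jacobian J eps t.1 =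
  row_mx (- eps *: (lin_om t *m (W t.1)^T + om t.1 *m (wedge_mx (incr_g t))^T))
         (eps *: (lin_om t *m ad_mx (mom t.1) + om t.1 *m ad_mx (incr_m t))
          + (1 - eps) *: (lin_gyr t *m P t.1 + gyr t.1 *m lin_P t)).
Proof.
have -> : t.2 - t.1 = row_mx (incr_g t) (incr_m t) by rewrite /incr_g /incr_m -!linearB hsubmxK.
rewrite /jacobian mul_row_block; congr row_mx.
  by rewrite (so_coords_tr_wedge (om t.1) (incr_g t)) lin_omE; exact: jacobian_row_g.
rewrite mul_lin_P /lin_gyr !(ad_mx_anti (om t.1)) lin_omE; exact: jacobian_row_m.
Qed.

(** Every summand on the right either is a product of two increments or contains a second-order
    remainder. *)
Lemma rolling_field_expand t : increment_dom t ->
  rolling_field J eps t.2 - rolling_field J eps t.1 - (t.2 - t.1) *m jacobian J eps t.1 =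
  row_mx (- eps *: (incr_om t *m (wedge_mx (incr_g t))^T + rem_om t *m (W t.1)^T))
         (eps *: (incr_om t *m ad_mx (incr_m t) + rem_om t *m ad_mx (mom t.1))
          + (1 - eps) *: (gyr t.1 *m rem_P t + lin_gyr t *m incr_P t + rem_gyr t *m P t.2)).
Proof.
move=> Dt; rewrite jacobian_apply /rolling_field !opp_row_mx !add_row_mx.
have e1 : om t.2 = om t.1 + (lin_om t + rem_om t) by rewrite -ang_vel_expand // /incr_om addrC subrK.
have e2 : gyr t.2 = gyr t.1 + (lin_gyr t + rem_gyr t) by rewrite -gyro_expand // addrC subrK.
have e3 : P t.2 = P t.1 + (lin_P t + rem_P t) by rewrite -pr_mx_expand // /incr_P addrC subrK.
have e4 : mom t.2 = mom t.1 + incr_m t by rewrite /incr_m addrC subrK.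
rewrite (ang_vel_expand Dt) (pr_mx_expand Dt) e1 e2 e3 wedge_mx_incr e4 [ad_mx (_ + _)]linearD /=.
rewrite [(W t.1 + _)^T]linearD /=.
move: (om t.1) (lin_om t) (rem_om t) (gyr t.1) (lin_gyr t) (rem_gyr t) (P t.1) (lin_P t) (rem_P t)
  (wedge_mx (incr_g t))^T (W t.1)^T (ad_mx (incr_m t)) (ad_mx (mom t.1)).
move=> w lw rw g lg rg p lp rp V G Am Ao.
congr row_mx.
  rewrite !(mulmxDr, mulmxDl, mulmxN, mulNmx).
  move: (w *m G) (lw *m G) (rw *m G) (w *m V) (lw *m V) (rw *m V) => A1 A2 A3 A4 A5 A6.
  by apply/rowP => i; rewrite !mxE; ring.
rewrite !(mulmxDr, mulmxDl, mulmxN, mulNmx).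
move: (w *m Ao) (lw *m Ao) (rw *m Ao) (w *m Am) (lw *m Am) (rw *m Am) => A1 A2 A3 A4 A5 A6.
move: (g *m p) (g *m lp) (g *m rp) (lg *m p) (lg *m lp) (lg *m rp) (rg *m p) (rg *m lp) (rg *m rp).
by move=> B1 B2 B3 B4 B5 B6 B7 B8 B9; apply/rowP => i; rewrite !mxE; ring.
Qed.

Lemma O_row_mx e p q (f : pair -> 'rV[R]_p) (g : pair -> 'rV[R]_q) :
  O e f -> O e g -> O e (fun t => row_mx (f t) (g t)).
Proof.
move=> [L L0 hL] [L' L'0 hL']; exists (L + L'); first exact: addr_ge0.
by move=> t Dt; rewrite mx_l1_row_mx mulrDl lerD ?hL ?hL'.
Qed.

Lemma O_rolling_field : O increment_sq (fun t =>
  rolling_field J eps t.2 - rolling_field J eps t.1 - (t.2 - t.1) *m jacobian J eps t.1).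
Proof.
apply: (bounded_by_ext (fun t Dt => esym (rolling_field_expand Dt))).
have hw := bounded_by_lin (@wedge_mx R n) O_incr_g.
apply: O_row_mx; last apply: bounded_byD; apply: bounded_byZ.
- apply: bounded_byD; first exact: O_sq O_incr_om (bounded_by_tr hw).
  exact: bounded_byMl O_rem_om (bounded_by_tr O_W1).
- apply: bounded_byD; first exact: O_sq O_incr_om (O_ad O_incr_m).
  exact: bounded_byMl O_rem_om (O_ad O_mom).
- apply: bounded_byD; last exact: bounded_byMl O_rem_gyr O_P2.
  apply: bounded_byD; first exact: bounded_byMr O_gyro O_rem_P.
  exact: O_sq O_lin_gyr O_incr_P.
Qed.

Lemma O_block_mx p q p' q' (f1 : pair -> 'M[R]_(p, q)) (f2 : pair -> 'M[R]_(p, q'))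
    (f3 : pair -> 'M[R]_(p', q)) (f4 : pair -> 'M[R]_(p', q')) :
  O (fun=> 1) f1 -> O (fun=> 1) f2 -> O (fun=> 1) f3 -> O (fun=> 1) f4 ->
  O (fun=> 1) (fun t => block_mx (f1 t) (f2 t) (f3 t) (f4 t)).
Proof.
move=> [L1 ? h1] [L2 ? h2] [L3 ? h3] [L4 ? h4].
exists (L1 + L2 + (L3 + L4)); first by rewrite !addr_ge0.
by move=> t Dt; rewrite mx_l1_col_mx !mx_l1_row_mx !mulrDl !lerD ?h1 ?h2 ?h3 ?h4.
Qed.

Lemma O_twist (x : pair -> 'rV[R]_K) :
  O (fun=> 1) x -> O (fun=> 1) (fun t => twist t.1 (x t)).
Proof.
move=> hx; apply: bounded_byMl O_W1 _; apply: bounded_byB.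
  exact: bounded_byMl (O_ad hx) O_P1.
exact: O_ad (bounded_byMl hx O_P1).
Qed.

Lemma O_jacobian : O (fun=> 1) (fun t => jacobian J eps t.1).
Proof.
have hE : O (fun=> 1) (fun t => dang_vel_g J t.1).
  exact: bounded_byMl (O_twist (bounded_byMl O_om (O_cst Q))) O_C1.
have hA := O_ad O_om; have hAJ := O_ad (bounded_byMl O_om (O_cst J)).
have hJA := bounded_byMl (O_cst J) hA; have hM := O_ad O_mom.
apply: O_block_mx.
- apply: bounded_byZ; apply: bounded_byB; last exact: bounded_by_lin O_om.
  by apply: bounded_byN; exact: bounded_byMl hE (bounded_by_tr O_W1).
- apply: bounded_byD; apply: bounded_byZ; first exact: bounded_byMl hE hM.
  apply: bounded_byD; last exact: O_twist O_gyro.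
  by apply: bounded_byN; exact: bounded_byMl (bounded_byMl hE (bounded_byB hAJ hJA)) O_P1.
- by apply: bounded_byZ; exact: bounded_byMl O_C1 (bounded_by_tr O_W1).
- apply: bounded_byD; apply: bounded_byZ.
    by apply: bounded_byD; [exact: bounded_byN hA|exact: bounded_byMl O_C1 hM].
  apply: bounded_byMl O_P1; apply: bounded_byD; last exact: bounded_byMl O_C1 hAJ.
  exact: bounded_byN (bounded_byMl O_C1 hJA).
Qed.

End Expansion.

Lemma rolling_expansion (R : realType) (n : nat) (J : 'M[R]_#|@upper_pairs n|) (D eps : R) :
  0 < D -> coercive J D ->
  first_order_expansion (@unit_phase R n) (rolling_field J eps) (jacobian J eps).
Proof.
move=> D0 hJ b.
have [L1 L10 h1] := O_rolling_field eps b D0 hJ; have [L2 L20 h2] := O_jacobian eps b D0 hJ.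
exists (L1 + L2); first exact: addr_ge0.
move=> y y' uy uy' yb; have Dt : increment_dom b (y, y') by [].
split; first by have := h2 _ Dt; rewrite mulr1 => /le_trans; apply; rewrite lerDr.
by have := h1 _ Dt => /le_trans; apply; rewrite mulrDl lerDl mulr_ge0 ?sqr_ge0.
Qed.

(** * The density along a solution *)

Section Density.
Variables (R : realType) (n : nat).
Local Notation K := #|@upper_pairs n|.
Local Notation N := (n.+1 + K)%N.
Variables (J : 'M[R]_K) (D eps T : R).
Hypotheses (Jsym : J^T = J) (D0 : 0 < D) (Jcoer : coercive J D) (eps0 : eps != 0).
Variable z : R -> 'rV[R]_N.
Hypothesis hz : solution (@unit_phase R n) (rolling_field J eps) T z.
Local Notation gam := (@lsubmx R 1 n.+1 K).
Local Notation om := (ang_vel J).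

Lemma is_derive_gam (s : R) : 0 <= s <= 1 -> forall l,
  is_derive s 1 (fun s => gam (z s) 0 l) ((T *: gam (rolling_field J eps (z s))) 0 l).
Proof.
move=> s01 l; have [_ /(_ (lshift _ l))] := hz s01.
by rewrite !mxE; under [X in _ -> is_derive _ _ X _]eq_fun do rewrite mxE.
Qed.

Lemma radial_solution (s : R) : 0 <= s <= 1 -> forall i,
  is_derive s 1 (fun s => row_mx (gam (z s)) (0 : 'rV[R]_K) 0 i)
    (T * (row_mx (gam (z s)) 0 *m jacobian J eps (z s)) 0 i).
Proof.
move=> s01 i; rewrite jacobian_radial; case: (split_ordP i) => l ->.
  under eq_fun do rewrite row_mxEl; rewrite row_mxEl.
  by apply: is_derive_eq (is_derive_gam s01 l) _; rewrite mxE.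
under eq_fun do rewrite row_mxEr mxE; rewrite row_mxEr mxE mulr0.
exact: is_derive_cst.
Qed.

Let rot s : 'rV[R]_K := - (T * eps) *: om (z s).

Lemma gam_rotation s : T *: gam (rolling_field J eps (z s)) =
  rot s *m (wedge_mx (gam (z s)))^T.
Proof. by rewrite row_mxKl scalerA -scalemxAl mulrN. Qed.

Lemma is_derive_wedge (s : R) : 0 <= s <= 1 -> forall i k,
  is_derive s 1 (fun s => wedge_mx (gam (z s)) i k)
    (wedge_mx (rot s *m (wedge_mx (gam (z s)))^T) i k).
Proof.
move=> s01 i k; have hg := is_derive_gam s01; rewrite -gam_rotation.
have -> : (fun s => wedge_mx (gam (z s)) i k) = (fun s =>
    ((enum_val k).1 == i)%:R * gam (z s) 0 (enum_val k).2
    - ((enum_val k).2 == i)%:R * gam (z s) 0 (enum_val k).1).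
  by apply/funext => v; rewrite wedge_mxE [X in _ - X]mulrC.
rewrite wedge_mxE [X in _ - X]mulrC.
have h1 := is_derive1Z (((enum_val k).1 == i)%:R : R) (hg (enum_val k).2).
have h2 := is_derive1Z (((enum_val k).2 == i)%:R : R) (hg (enum_val k).1).
exact: is_derive1B h1 h2.
Qed.

Lemma gram_rot (s : R) :
  (wedge_mx (rot s *m (wedge_mx (gam (z s)))^T))^T *m wedge_mx (gam (z s)) +
  (wedge_mx (gam (z s)))^T *m wedge_mx (rot s *m (wedge_mx (gam (z s)))^T) =
  pr_mx (gam (z s)) *m ad_mx (rot s) - ad_mx (rot s) *m pr_mx (gam (z s)).
Proof.
rewrite wedge_mx_rot /pr_mx.
have hA := ad_mx_skew (rot s); have hS : (so_of (rot s))^T = - so_of (rot s) := so_of_so _.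
move: (wedge_mx _) (ad_mx _) (so_of _) hA hS => G A S hA hS.
rewrite [(_ + _)^T]linearD /= !trmx_mul hA hS mulmxDl mulmxDr !mulNmx mulmxN mulNmx !mulmxA.
move: (A *m _ *m _) (G^T *m S *m G) (_ *m A) => A1 A2 A3.
by apply/matrixP => i j; rewrite !mxE; ring.
Qed.

Lemma is_derive_momentum (s : R) : 0 <= s <= 1 -> forall i j,
  is_derive s 1 (fun s => momentum_mx J (gam (z s)) i j)
    (((J - 1%:M) *m (pr_mx (gam (z s)) *m ad_mx (rot s)
                     - ad_mx (rot s) *m pr_mx (gam (z s)))) i j).
Proof.
move=> s01 i j; have hW := is_derive_wedge s01.
have hP k l : is_derive s 1 (fun s => pr_mx (gam (z s)) k l)
   ((pr_mx (gam (z s)) *m ad_mx (rot s) - ad_mx (rot s) *m pr_mx (gam (z s))) k l).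
  rewrite -gram_rot mxE [X in X + _]mxE [X in _ + X]mxE -big_split /=.
  under eq_fun do rewrite /pr_mx mxE.
  apply: is_derive1_sum => a; under eq_fun do rewrite mxE.
  apply: is_derive_eq (is_derive1M (hW a k) (hW a l)) _.
  by rewrite ![_^T _ _]mxE addrC; congr (_ + _); rewrite mulrC.
move: (_ - _) hP => B hP.
have -> : (fun s => momentum_mx J (gam (z s)) i j) = (fun s => (1%:M : 'M[R]_K) i j +
    \sum_k (J - 1%:M) i k * pr_mx (gam (z s)) k j).
  by apply/funext => v; rewrite /momentum_mx [LHS]mxE [X in _ + X]mxE.
rewrite [(_ *m B) i j]mxE -[X in is_derive _ _ _ X]add0r.
have hs := is_derive1_sum (index_enum _) xpredT (fun k => is_derive1Z ((J - 1%:M) i k) (hP k j)).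
exact: is_derive1D (is_derive_cst ((1%:M : 'M[R]_K) i j) s 1) hs.
Qed.

Lemma is_derive_density (s : R) : 0 <= s <= 1 ->
  is_derive s 1 (fun s => \det (momentum_mx J (gam (z s))) `^ ((2 * eps)^-1 - 1))
    (- (T * \tr (jacobian J eps (z s)) * \det (momentum_mx J (gam (z s))) `^ ((2 * eps)^-1 - 1))).
Proof.
move=> s01; have [z1 _] := hz s01.
have d0 := det_momentum_mx_gt0 D0 Jcoer z1.
have hd := is_derive1_det (is_derive_momentum s01).
have := is_derive1_comp (is_derive1_powR ((2 * eps)^-1 - 1) d0) hd.
move=> /is_derive_eq; apply.
have Bu := momentum_mx_unit D0 Jcoer z1.
have adjE : \adj (momentum_mx J (gam (z s))) =
    \det (momentum_mx J (gam (z s))) *: resolvent J (z s).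
  by rewrite /resolvent /invmx Bu scalerA mulfV ?scale1r // gt_eqF.
rewrite adjE -scalemxAr mxtraceZ mxtrace_mulC.
rewrite (mxtrace_dlogdet (pr_mx_sym (gam (z s))) (Qsym Jsym) (momentum_resolvent D0 Jcoer z1) (ad_mx_skew _)).
rewrite (trace_jacobian eps Jsym D0 Jcoer z1) /rot linearZ /= -scalemxAr mxtraceZ.
move: (\tr _) => c; set d := \det _ in d0 *; set p := (2 * eps)^-1 - 1.
have -> : d `^ (p - 1) = d `^ p / d.
  rewrite (@powRB _ d p 1) ?powRr1 ?(ltW d0) //.
  by apply/implyP => _; rewrite gt_eqF.
(* The exponent is the solution p of 2 eps p = 1 - 2 eps, the ratio of the two trace formulas; eps
   != 0 enters here. *)
move: (d `^ p) => dp; rewrite /p; field.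
by rewrite eps0 gt_eqF.
Qed.

End Density.

(** * The determinant on v_g *)

Section Inertia.
Variables (R : realType) (n : nat).
Local Notation K := #|@upper_pairs n|.
Local Notation so_basis := (@so_basis R n).
Variables (II : {linear 'M[R]_n.+1 -> 'M[R]_n.+1}) (D : R).
Hypotheses (hII : sym_posdef_on_so II) (D0 : 0 < D).
Implicit Types (X Y : 'M[R]_n.+1) (g : 'rV[R]_n.+1).

Definition inertia_mx : 'M[R]_K :=
  \matrix_k so_coords (total_inertia II D (so_basis k)).

Lemma so_basis_so k : so n.+1 (so_basis k).
Proof. exact: so_wedge. Qed.

Lemma so_coords_basis k : so_coords (so_basis k) = 'e_k.
Proof.
rewrite -['e_k in RHS]so_ofK /so_of (bigD1 k) //= big1 ?addr0.
  by rewrite mxE !eqxx scale1r.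
by move=> j /negbTE jk; rewrite mxE jk andbF scale0r.
Qed.

Lemma total_inertia_so X : so n.+1 X -> so n.+1 (total_inertia II D X).
Proof.
move=> hX; rewrite /total_inertia addrC; apply: so_lin => //.
by have [h _ _] := hII; exact: h.
Qed.

Lemma mul_inertia_mx X : so n.+1 X ->
  so_coords X *m inertia_mx = so_coords (total_inertia II D X).
Proof.
move=> hX; rewrite -{2}(so_coordsK hX) mulmx_sum_row /so_of /total_inertia linear_sum scaler_sumr.
rewrite -big_split linear_sum; apply: eq_bigr => k _ /=.
rewrite rowK -linearZ /=; congr so_coords.
by rewrite /total_inertia linearZ /= scalerDr !scalerA [D * _]mulrC.
Qed.

Lemma inertia_mx_dot X Y : so n.+1 X -> so n.+1 Y ->
  (so_coords X *m inertia_mx *m (so_coords Y)^T) 0 0 = so_dot (total_inertia II D X) Y.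
Proof.
by move=> hX hY; rewrite mul_inertia_mx // -so_dotE //; exact: total_inertia_so.
Qed.

Lemma so_dotDZ X Y Z a : so_dot (X + a *: Y) Z = so_dot X Z + a * so_dot Y Z.
Proof. by rewrite /so_dot mulmxDl mxtraceD -scalemxAl mxtraceZ; ring. Qed.

Lemma so_dotC X Y : so_dot X Y = so_dot Y X.
Proof. by rewrite /so_dot mxtrace_mulC. Qed.

Lemma inertia_mx_sym : inertia_mx^T = inertia_mx.
Proof.
have e k l : inertia_mx k l = so_dot (total_inertia II D (so_basis k)) (so_basis l).
  rewrite so_dot_basis; last by apply: total_inertia_so; exact: so_basis_so.
  by rewrite [LHS]mxE.
have [_ hs _] := hII.
apply/matrixP => k l; rewrite [LHS]mxE !e /total_inertia !so_dotDZ.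
rewrite (hs _ _ (so_basis_so l) (so_basis_so k)) [so_dot (so_basis l) (II _)]so_dotC.
by rewrite [so_dot (so_basis l) _]so_dotC.
Qed.

Lemma inertia_mx_coercive : coercive inertia_mx D.
Proof.
move=> x; have hx := so_of_so x; have [_ _ hp] := hII.
rewrite -[x]so_ofK inertia_mx_dot // -so_dotE // so_dotDZ lerDr.
have [->|x0] := eqVneq (so_of x) 0; first by rewrite linear0 /so_dot mul0mx mxtrace0 mulr0.
exact/ltW/hp.
Qed.

(** A linear function of its last argument, given a canonical linear structure so that the [linfun]
    in [v_space] can be evaluated by [lfunE]. *)
Definition wedge_by (g x : 'cV[R]_n.+1) : 'M[R]_n.+1 := wedge x g.

Lemma wedge_by_is_linear (g : 'cV[R]_n.+1) : linear (wedge_by g).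
Proof.
move=> a x y; rewrite /wedge_by /wedge linearP /= mulmxDl mulmxDr -scalemxAl -scalemxAr.
by rewrite scalerBr opprD addrACA.
Qed.
HB.instance Definition _ (g : 'cV[R]_n.+1) :=
  GRing.isLinear.Build R 'cV[R]_n.+1 'M[R]_n.+1 _ (wedge_by g) (wedge_by_is_linear g).

Lemma v_spaceP (g : 'cV[R]_n.+1) X :
  reflect (exists x : 'cV[R]_n.+1, X = wedge x g) (X \in v_space g).
Proof.
have E (x : 'cV[R]_n.+1) : linfun (fun x => wedge x g) x = wedge x g := lfunE (wedge_by g) x.
apply: (iffP memv_imgP) => [[x _ ->]|[x ->]]; exists x; rewrite ?E ?memvf //.
Qed.

Lemma pr_v_wedge g X : so n.+1 X -> pr_v g^T X = wedge (X *m g^T) g^T.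
Proof.
move=> hX; rewrite /pr_v /wedge /tensor trmx_mul trmxK.
by have /= -> := hX; rewrite !mulmxN opprK !mulmxA.
Qed.

(** With V the coordinates of a basis of v_g and U' those of the projected basis of so(n) in it, U'
    V = P and V U' = 1. Hence det (1 + Q U' V) = det (1 + V Q U') = det (V J U'), the determinant of
    the compression. The basis of v_g need not be orthonormal, since U' takes the place of the
    transpose of V. *)
Lemma det_on_v_space g : unit_row g ->
  det_on (v_space g^T) (pr_v g^T \o total_inertia II D) = \det (momentum_mx inertia_mx g).
Proof.
move=> g1; set U := v_space g^T.
pose bs (i : 'I_(\dim U)) : 'M[R]_n.+1 := (vbasis U)`_i.
have bU i : bs i \in U by apply: vbasis_mem; apply: mem_nth; rewrite size_tuple.
have Uso X : X \in U -> so n.+1 X by move=> /v_spaceP[x ->]; exact: so_wedge.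
have prU X : so n.+1 X -> pr_v g^T X \in U.
  by move=> hX; apply/v_spaceP; exists (X *m g^T); exact: pr_v_wedge.
have prK X : X \in U -> so_coords X *m pr_mx g = so_coords X.
  move=> /v_spaceP[x ->]; rewrite -[x]trmxK -mul_wedge_mx /pr_mx !mulmxA.
  rewrite -[_ *m wedge_mx g *m _]mulmxA wedge_mx_tr_mul g1 scale1r mulmxBr mulmx1 mulmxBl.
  by rewrite -!mulmxA mulmx_wedge_mx_self !mulmx0 subr0.
pose V : 'M[R]_(\dim U, K) := \matrix_i so_coords (bs i).
have coords X : X \in U -> \row_i coord (vbasis U) i X *m V = so_coords X.
  move=> hX; rewrite mulmx_sum_row {2}(coord_vbasis hX) linear_sum.
  by apply: eq_bigr => i _; rewrite mxE rowK linearZ.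
pose U' : 'M[R]_(K, \dim U) := \matrix_k \row_i coord (vbasis U) i (pr_v g^T (so_basis k)).
have PE : U' *m V = pr_mx g.
  apply/row_matrixP => k; rewrite row_mul rowK coords ?prU //; last exact: so_basis_so.
  by rewrite so_coords_pr_v; [rewrite so_coords_basis rowE|exact: so_basis_so].
have VP : V *m pr_mx g = V.
  by apply/row_matrixP => i; rewrite row_mul rowK prK.
have Vfree : row_free V.
  rewrite -kermx_eq0; apply/eqP/row_matrixP => k; rewrite row0.
  have : row k (kermx V) *m V = 0 by rewrite -row_mul mulmx_ker row0.
  move: (row k _) => x; rewrite mulmx_sum_row.
  under eq_bigr do rewrite rowK -linearZ /=.
  rewrite -linear_sum /= => /so_coords_inj h.
  have /freeP/(_ (x 0)) f := basis_free (vbasisP U).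
  apply/rowP => i; rewrite [RHS]mxE; apply: f; apply: h.
  apply: Uso; apply: memv_suml => j _; exact: memvZ.
have VU : V *m U' = 1%:M.
  by apply: (row_free_inj Vfree); rewrite /= -mulmxA PE VP mul1mx.
pose T := \matrix_(i < \dim U, j < \dim U)
          coord (vbasis U) j ((pr_v g^T \o total_inertia II D) (bs i)).
have TV : T *m V = V *m inertia_mx *m pr_mx g.
  apply/row_matrixP => i; rewrite !row_mul rowK mul_inertia_mx; last exact: Uso (bU i).
  have hI := total_inertia_so (Uso _ (bU i)).
  rewrite -so_coords_pr_v // -(coords _ (prU _ hI)); congr (_ *m _).
  by apply/rowP => j; rewrite !mxE.
have TE : V *m inertia_mx *m U' = T.
  by apply: (row_free_inj Vfree); rewrite /= TV -PE mulmxA.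
rewrite /momentum_mx -PE mulmxA det_1pmulC mulmxA mulmxBr mulmx1 mulmxBl VU TE.
by rewrite addrC subrK.
Qed.

End Inertia.

(** * Diagonal inertia *)

Section DiagonalInertia.
Variables (R : realType) (n : nat).
Local Notation K := #|@upper_pairs n|.
Variables (II : {linear 'M[R]_n.+1 -> 'M[R]_n.+1}) (D : R) (a : 'I_n.+1 -> R).
Hypotheses (hII : sym_posdef_on_so II) (apos : forall i, 0 < a i).
Hypothesis hdiag : forall i j : 'I_n.+1, (i < j)%N ->
  II (wedge (basis_vec i) (basis_vec j)) =
  (a i * a j - D) *: wedge (basis_vec i) (basis_vec j).
Implicit Types (X : 'M[R]_n.+1) (g : 'rV[R]_n.+1).

Let A : 'M[R]_n.+1 := diag_mx (\row_i a i).

Lemma mul_diag_basis i : A *m basis_vec i = a i *: basis_vec i.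
Proof.
apply/colP => j; rewrite mul_diag_mx !mxE; case: eqP => [->//|_].
by rewrite !mulr0.
Qed.

Lemma diag_tr : A^T = A.
Proof. exact: tr_diag_mx. Qed.

(** The multipliers a_i a_j are those of x /\ y |-> A x /\ A y. *)
Lemma total_inertia_diag X : so n.+1 X -> total_inertia II D X = A *m X *m A.
Proof.
move=> hX; rewrite -(so_coordsK hX) /so_of /total_inertia linear_sum scaler_sumr.
rewrite mulmx_sumr mulmx_suml -big_split; apply: eq_bigr => k _ /=.
rewrite linearZ /= hdiag ?upper_pairP // -scalemxAr -scalemxAl !scalerA -scalerDl.
have -> : A *m so_basis R k *m A = (a (enum_val k).1 * a (enum_val k).2) *: so_basis R k.
  rewrite /so_basis /wedge mulmxBr mulmxBl !mulmxA !mul_diag_basis -!scalemxAl -!mulmxA.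
  rewrite -{2}diag_tr -trmx_mul mul_diag_basis -{1}diag_tr -trmx_mul mul_diag_basis.
  have t (c : R) i : (c *: basis_vec i)^T = c *: (basis_vec i : 'cV[R]_n.+1)^T by rewrite linearZ.
  by rewrite !t -!scalemxAr !scalerA scalerBr [a (enum_val k).2 * _]mulrC.
by rewrite scalerA -/(so_basis R k); congr (_ *: _); ring.
Qed.

(** Contraction of A x /\ A g with g. *)
Lemma wedge_inertia_wedge g :
  wedge_mx g *m inertia_mx II D *m (wedge_mx g)^T =
  (g *m A *m g^T) 0 0 *: A - (g *m A)^T *m (g *m A).
Proof.
apply/row_matrixP => i; rewrite !row_mul rowK mul_inertia_mx; last exact: so_wedge.
have hw := so_wedge (basis_vec i) g^T.
rewrite mul_wedge_mx_tr; last exact: total_inertia_so.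
rewrite total_inertia_diag // /wedge trmxK mulmxBr !mulmxBl.
have e1 : A *m (basis_vec i *m g) *m A *m g^T = (g *m A *m g^T) 0 0 *: (A *m basis_vec i).
  have -> : A *m (basis_vec i *m g) *m A *m g^T = A *m basis_vec i *m (g *m A *m g^T) by rewrite !mulmxA.
  by rewrite {1}[g *m A *m g^T]mx11_scalar mul_mx_scalar.
rewrite e1 linearB /= linearZ /= [RHS]linearB /= linearZ /=; congr (_ *: _ - _).
  by rewrite trmx_mul diag_tr /basis_vec trmx_delta -rowE.
have -> : A *m (g^T *m (basis_vec i)^T) *m A *m g^T =
          (g *m A)^T *m (g *m A *m basis_vec i)^T by rewrite !trmx_mul diag_tr !mulmxA.
rewrite trmx_mul !trmxK row_mul; congr (_ *m _); apply/matrixP => k l.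
by rewrite !ord1 /basis_vec -colE !mxE.
Qed.

Lemma det_mx2 (M : 'M[R]_2) : \det M = M 0 0 * M 1 1 - M 0 1 * M 1 0.
Proof.
rewrite (expand_det_row _ ord0) !big_ord_recl big_ord0 addr0 /cofactor !det_mx11 !mxE /=.
have -> : lift ord0 ord0 = 1 :> 'I_2 by exact: val_inj.
have -> : lift 1 ord0 = 0 :> 'I_2 by exact: val_inj.
by rewrite expr0 expr1 mul1r mulN1r mulrN.
Qed.

Lemma det_block_2 (x y v w : R) :
  \det (block_mx x%:M y%:M v%:M w%:M : 'M[R]_(1 + 1)) = x * w - y * v.
Proof.
pose B : 'M[R]_(1 + 1) := block_mx x%:M y%:M v%:M w%:M.
have b1 : B (lshift 1 0) (lshift 1 0) = x by rewrite block_mxEul mxE.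
have b2 : B (lshift 1 0) (rshift 1 0) = y by rewrite block_mxEur mxE.
have b3 : B (rshift 1 0) (lshift 1 0) = v by rewrite block_mxEdl mxE.
have b4 : B (rshift 1 0) (rshift 1 0) = w by rewrite block_mxEdr mxE.
have -> := det_mx2 B.
have -> : (0 : 'I_2) = lshift 1 (0 : 'I_1) by exact: val_inj.
have -> : (1 : 'I_2) = rshift 1 (0 : 'I_1) by exact: val_inj.
by congr (_ * _ - _ * _); [exact: b1|exact: b4|exact: b2|exact: b3].
Qed.

Lemma diag_quad_gt0 g : unit_row g -> 0 < (g *m A *m g^T) 0 0.
Proof.
move=> g1; have qE : (g *m A *m g^T) 0 0 = \sum_i a i * g 0 i ^+ 2.
  rewrite mxE; apply: eq_bigr => i _; rewrite mul_mx_diag !mxE; ring.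
have pos i : 0 <= a i * g 0 i ^+ 2 by rewrite mulr_ge0 ?sqr_ge0 ?(ltW (apos i)).
rewrite qE lt_neqAle sumr_ge0 // andbT eq_sym; apply/negP => /eqP h.
have : (g *m g^T) 0 0 = 0.
  rewrite -sumsqE; apply: big1 => i _.
  move/eqP: h; rewrite psumr_eq0 // => /allP/(_ i (mem_index_enum i)) /=.
  by rewrite mulf_eq0 gt_eqF //= => /eqP.
by rewrite (g1 : (g *m g^T) 0 0 = 1) => /eqP; rewrite oner_eq0.
Qed.

(** Sylvester's identity leads to det (q A + g^T g - h^T h) with h = g A, a perturbation of q A of
    rank at most two. The quotient of powers stays correct when n.+1 < 2, where a difference of
    natural exponents would be truncated. *)
Lemma det_momentum_diag g : unit_row g ->
  \det (momentum_mx (inertia_mx II D) g) =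
  (g *m A *m g^T) 0 0 ^+ n.+1 / (g *m A *m g^T) 0 0 ^+ 2 * \prod_i a i.
Proof.
move=> g1; set q := (g *m A *m g^T) 0 0.
have q0 : q != 0 by rewrite gt_eqF // diag_quad_gt0.
rewrite /momentum_mx /pr_mx mulmxA det_1pmulC mulmxA mulmxBr mulmx1 mulmxBl.
rewrite wedge_inertia_wedge wedge_mx_tr_mul g1 scale1r -/q.
set h := g *m A.
have -> : 1%:M + (q *: A - h^T *m h - (1%:M - g^T *m g)) =
          q *: A + row_mx g^T (- h^T) *m col_mx g h.
  rewrite mul_row_col mulNmx; move: (q *: A) (h^T *m h) (g^T *m g) => B1 B2 B3.
  by apply/matrixP => i j; rewrite !mxE; ring.
pose B : 'M[R]_n.+1 := diag_mx (\row_i (a i)^-1).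
have AB : A *m B = 1%:M.
  rewrite /A /B mulmx_diag; apply/matrixP => i j; rewrite !mxE.
  by case: eqP => // _; rewrite divff // gt_eqF.
have -> : q *: A + row_mx g^T (- h^T) *m col_mx g h =
          q *: A *m (1%:M + (q^-1 *: B) *m row_mx g^T (- h^T) *m col_mx g h).
  rewrite mulmxDr mulmx1; congr (_ + _).
  by rewrite !mulmxA -scalemxAl -scalemxAr scalerA mulfV // scale1r AB mul1mx.
rewrite det_mulmx detZ det_diag det_1pmulC.
have Bh : B *m h^T = g^T by rewrite /h trmx_mul diag_tr mulmxA (mulmx1C AB) mul1mx.
(* In the lower right corner h A^-1 h^T = q gives -1, which the added identity cancels. The
   determinant is then q^-2, whatever the upper left entry. *)
have -> : col_mx g h *m (q^-1 *: B *m row_mx g^T (- h^T)) =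
   block_mx (q^-1 * (g *m B *m g^T) 0 0)%:M (- q^-1)%:M (q^-1)%:M (- 1)%:M.
  rewrite mul_mx_row mul_col_row mulmxN -!scalemxAl Bh.
  have hB : h *m B = g by rewrite -mulmxA AB mulmx1.
  have gg : g *m g^T = 1%:M by rewrite [g *m g^T]mx11_scalar g1.
  have hg : h *m g^T = q%:M by rewrite [h *m g^T]mx11_scalar.
  rewrite !mulmxN -!scalemxAr !mulmxA hB gg hg.
  congr block_mx.
  - by rewrite {1}[g *m B *m g^T]mx11_scalar scale_scalar_mx.
  - by rewrite -[in RHS]scalemx1 scaleNr.
  - by rewrite scalemx1.
  - by rewrite scale_scalar_mx mulVf // -[in RHS]scalemx1 scaleN1r.
rewrite (_ : 1%:M = block_mx (1%:M : 'M[R]_1) 0 0 (1%:M : 'M[R]_1)); last first.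
  by rewrite -scalar_mx_block.
rewrite add_block_mx !add0r -!raddfD /= det_block_2 subrr mulr0 sub0r mulNr opprK.
rewrite (eq_bigr a) => [|i _]; last by rewrite mxE.
by field.
Qed.

Lemma density_diag (eps : R) (g : 'cV[R]_n.+1) : sphere n.+1 g ->
  density II D eps g = (\prod_i a i) `^ ((2 * eps)^-1 - 1) *
    dotv g (A *m g) `^ (((2 * eps)^-1 - 1) * (n.+1%:R - 2)).
Proof.
move=> hg; have g1 : unit_row g^T by rewrite /unit_row trmxK.
rewrite /density -{1 2}[g]trmxK det_on_v_space // det_momentum_diag // trmxK.
rewrite /dotv mulmxA; have := diag_quad_gt0 g1; rewrite trmxK.
move: ((g^T *m A *m g) 0 0) => q q0; move: ((2 * eps)^-1 - 1) => p.
have pa : 0 <= \prod_i a i by apply: prodr_ge0 => i _; exact: ltW.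
rewrite powRM //; last by rewrite divr_ge0 // exprn_ge0 // ltW.
rewrite mulrC; congr (_ * _); rewrite [p * _]mulrC powRrM; congr (_ `^ _).
rewrite powRB; last by apply/implyP => _; rewrite gt_eqF.
by rewrite !powR_mulrn // ltW.
Qed.

End DiagonalInertia.

(** * Invariance of the form *)

Section Flow.
Variables (R : realType) (n : nat).
Local Notation K := #|@upper_pairs n|.
Local Notation N := (n.+1 + K)%N.
Local Notation phase := (@phase R n).
Implicit Types (x y : phase) (z : 'rV[R]_N).

Lemma phase_coords_lin (a : R) x y :
  phase_coords (a *: x + y) = a *: phase_coords x + phase_coords y.
Proof.
by rewrite /phase_coords scale_row_mx add_row_mx; congr row_mx; rewrite linearP.
Qed.

Lemma phase_coords_quotient (h : R) x y i :
  phase_coords (h *: (x - y)) 0 i = h *: (phase_coords x 0 i - phase_coords y 0 i).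
Proof.
have -> : h *: (x - y) = h *: x + ((- h) *: y + 0) by rewrite addr0 scaleNr scalerBr.
rewrite !phase_coords_lin.
have -> : phase_coords (0 : phase) = 0 by rewrite /phase_coords !linear0 row_mx0.
by rewrite addr0 !mxE mulNr -mulrBr.
Qed.

Lemma phase_coord_continuous i : continuous (fun x : phase => phase_coords x 0 i).
Proof.
move=> x; rewrite /phase_coords; case: (split_ordP i) => l ->.
  rewrite (_ : (fun _ => _) = (fun x : phase => x.2 l 0)); last first.
    by apply/funext => y; rewrite row_mxEl mxE.
  by apply: (continuous_comp (g := fun M : 'cV[R]_n.+1 => M l 0)); [exact: cvg_snd|exact: coord_continuous].
rewrite (_ : (fun _ => _) = (fun x : phase => x.1 (enum_val l).1 (enum_val l).2)); last first.
  by apply/funext => y; rewrite row_mxEr mxE.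
by apply: (continuous_comp (g := fun M : 'M[R]_n.+1 => M (enum_val l).1 (enum_val l).2));
  [exact: cvg_fst|exact: coord_continuous].
Qed.

Lemma is_derive_phase_coord (f : R -> phase) (s : R) (v : phase) : is_derive s 1 f v ->
  forall i, is_derive s 1 (fun t => phase_coords (f t) 0 i) (phase_coords v 0 i).
Proof.
move=> [df dv] i.
have H : h^-1 *: (phase_coords (f (h *: (1 : R) + s)) 0 i - phase_coords (f s) 0 i)
    @[h --> 0^'] --> phase_coords v 0 i.
  under eq_fun do rewrite -phase_coords_quotient.
  rewrite -dv; apply: (cvg_comp _ (fun x : phase => phase_coords x 0 i) df).
  exact: phase_coord_continuous.
by apply: DeriveDef; [apply/cvg_ex; exists (phase_coords v 0 i)|apply: cvg_lim].
Qed.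

Definition of_coords z : phase := (so_of (rsubmx z), (lsubmx z)^T).

Lemma of_coordsK z : phase_coords (of_coords z) = z.
Proof. by rewrite /phase_coords /of_coords /= trmxK so_ofK hsubmxK. Qed.

Lemma phase_coordsK x : so n.+1 x.1 -> of_coords (phase_coords x) = x.
Proof.
move=> hx; rewrite /of_coords row_mxKl row_mxKr trmxK so_coordsK //.
by case: x hx.
Qed.

Lemma of_coords_lin (a : R) z z' :
  of_coords (a *: z + z') = a *: of_coords z + of_coords z'.
Proof.
rewrite /of_coords; congr (_, _).
  by rewrite !linearP.
by rewrite !linearP.
Qed.

Lemma of_coords_sum z : of_coords z = \sum_i z 0 i *: of_coords 'e_i.
Proof.
rewrite {1}(row_sum_delta z); elim/big_rec2: _ => [|i w w' _ <-].
  by rewrite /of_coords !linear0.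
by rewrite of_coords_lin.
Qed.

Lemma is_derive_of_coords (f : R -> 'rV[R]_N) (s : R) (w : 'rV[R]_N) :
  (forall i, is_derive s 1 (fun t => f t 0 i) (w 0 i)) ->
  is_derive s 1 (fun t => of_coords (f t)) (of_coords w).
Proof.
move=> H.
have -> : (fun t => of_coords (f t)) = \sum_(i < N) (fun t => f t 0 i *: of_coords 'e_i).
  by apply/funext => t; rewrite of_coords_sum fct_sumE.
rewrite of_coords_sum; apply: is_derive_sum => i.
have [df dv] := H i.
have h1 : h^-1 *: (f (h *: (1 : R) + s) 0 i *: of_coords 'e_i - f s 0 i *: of_coords 'e_i)
    @[h --> 0^'] --> w 0 i *: of_coords 'e_i.
  under eq_fun do rewrite -scalerBl scalerA.
  by apply: cvgZr_tmp; rewrite -dv; exact: df.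
by apply: DeriveDef; [apply/cvg_ex; exists (w 0 i *: of_coords 'e_i)|apply: cvg_lim].
Qed.

Variables (II : {linear 'M[R]_n.+1 -> 'M[R]_n.+1}) (D eps : R).
Hypotheses (hII : sym_posdef_on_so II) (D0 : 0 < D) (eps0 : eps != 0).
Local Notation J := (inertia_mx II D).

Lemma phase_space_unit x : phase_space x -> unit_phase (phase_coords x).
Proof. by move=> [_ h]; rewrite /unit_phase /unit_row row_mxKl trmxK. Qed.

(** In coordinates the first equation is m = omega B(g); invertibility of B determines omega, so the
    implicit relation becomes an explicit field. *)
Lemma rubber_rolling_coords x v : phase_space x -> rubber_rolling II D eps x v ->
  phase_coords v = rolling_field J eps (phase_coords x).
Proof.
move=> hx [w [hw e1 e2 e3]]; have z1 := phase_space_unit hx.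
have Jc := inertia_mx_coercive D hII.
have hx1 : so n.+1 x.1 := hx.1.
have hIw := total_inertia_so D hII hw.
set g := x.2^T; have gE : x.2 = g^T by rewrite /g trmxK.
have hm : so_coords x.1 = so_coords w *m momentum_mx J g.
  rewrite e1 /pr_h gE linearD /= linearB /= !so_coords_pr_v // -mul_inertia_mx //.
  rewrite -/(pr_mx g) /momentum_mx mulmxDr mulmx1 [so_coords w *m (_ *m pr_mx g)]mulmxA.
  by rewrite [so_coords w *m (_ - _)]mulmxBr mulmx1 mulmxBl addrCA.
have om : ang_vel J (phase_coords x) = so_coords w.
  rewrite /ang_vel /resolvent row_mxKr row_mxKl hm -mulmxA mulmxV ?mulmx1 //.
  by apply: (momentum_mx_unit D0 Jc); rewrite /g; have := z1; rewrite /unit_phase row_mxKl.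
rewrite /rolling_field /gyro om row_mxKl row_mxKr -/g /phase_coords; congr row_mx.
  rewrite e3 linearN /= linearZ /= mul_wedge_mx_tr // /g trmxK scaleNr.
  by [].
rewrite e2 linearD /= !linearZ /= gE so_coords_pr_v; last exact: so_bracket.
rewrite !mul_ad_mx !so_coordsK // mul_inertia_mx // so_coordsK //.
Qed.

(** The flow domain contains (s t, y) for s in [0, 1], for either sign of t. *)
Lemma flow_solution (U : set (R * phase)) (phi : R -> phase -> phase) (t : R) y :
  is_local_flow phase_space (rubber_rolling II D eps) U phi ->
  phase_space y -> U (t, y) ->
  solution (@unit_phase R n) (rolling_field J eps) t
    (fun s => phase_coords (phi (s * t) y)).
Proof.
move=> [_ Uconv _ hphi] hy hU s /andP[s0 s1].
have hU' : U (s * t, y).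
  apply: (Uconv y (s * t) t hy hU); case: (leP 0 t) => t0; apply/orP; [left|right].
    by rewrite mulr_ge0 //= ler_piMl.
  by rewrite mulr_ge0_le0 ?(ltW t0) // andbT ler_niMl ?(ltW t0).
have [hM [v hF hd]] := hphi y _ hy hU'.
split; first exact: phase_space_unit.
move=> i; rewrite -(rubber_rolling_coords hM hF).
have h1 := is_derive_phase_coord hd i.
have h2 : is_derive s 1 (fun s : R => s * t) t.
  under eq_fun do rewrite mulrC; rewrite -[t in is_derive _ _ _ t]mulr1.
  by apply: is_derive1Z; exact: is_derive_id.
by have := @is_derive1_comp R (fun r => phase_coords (phi r y) 0 i) (fun r => r * t) s _ _ h1 h2 => /is_derive_eq; apply; rewrite mulrC.
Qed.

Lemma density_coords x : phase_space x -> density II D eps x.2 =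
  \det (momentum_mx J (lsubmx (phase_coords x))) `^ ((2 * eps)^-1 - 1).
Proof.
move=> hx; have := phase_space_unit hx; rewrite /unit_phase row_mxKl => g1.
by rewrite -(det_on_v_space D hII g1) trmxK.
Qed.

Lemma rubber_rolling_invariant_form :
  flow_preserves_form phase_space (rubber_rolling II D eps) (invariant_form II D eps).
Proof.
move=> U phi hflow x t hx hU c u hc.
have [Uopen Uconv phi0 hphi] := hflow.
have Jc := inertia_mx_coercive D hII; have Js := inertia_mx_sym D hII.
pose Z k h s := phase_coords (phi (s * t) (c k h)).
pose z s := phase_coords (phi (s * t) x).
have hz := flow_solution hflow hx hU.
have nearU k : \forall h \near (0 : R), phase_space (c k h) /\ U (t, c k h).
  have [ck0 ckM ckd] := hc k.
  have cc : {for 0, continuous (c k)}.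
    by apply: differentiable_continuous; apply/derivable1_diffP; case: ckd.
  (* Openness of U and continuity of the curve at 0 keep neighbouring points in the flow domain up
     to time t. *)
  have nU : nbhs (t, c k 0) U by apply: open_nbhs_nbhs; split => //; rewrite ck0.
  have [[A B] [/= hA hB] AB] := nU.
  have hcB : \forall h \near (0 : R), B (c k h) by exact: cc B hB.
  apply: filterS2 ckM hcB => h hM hBh; split => //.
  by apply: AB; split => //=; exact: nbhs_singleton.
have Zsol k : \forall h \near (0 : R), solution (@unit_phase R n) (rolling_field J eps) t (Z k h).
  by have := nearU k; apply: filterS => h [h1 h2]; exact: (flow_solution hflow).
have Z0 k : Z k 0 = z by rewrite /Z; have [-> _ _] := hc k.
have Zu k i : is_derive (0 : R) 1 (fun h => Z k h 0 0 i) (phase_coords (u k) 0 i).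
  have [ck0 ckM ckd] := hc k.
  apply: near_eq_is_derive (is_derive_phase_coord ckd i).
  have := nearU k; apply: filterS => h [h1 h2].
  rewrite /Z mul0r phi0 //; apply: (Uconv _ _ _ h1 h2).
  by rewrite lexx /=; case: (leP 0 t) => // /ltW ->; rewrite orbT.
have expd := rolling_expansion eps D0 Jc.
have /choice[w hw] k : exists w : 'rV[R]_N, forall i,
    is_derive (0 : R) 1 (fun h => Z k h 1 0 i) (w 0 i).
  exact: (variation_derivable expd (Zsol k) (Zu k)).
exists (fun k => of_coords (w k)).
  (* [of_coords] inverts [phase_coords] only on skew matrices, hence the appeal to the flow staying
     in the phase space near h = 0. *)
  move=> k; have := is_derive_of_coords (hw k); apply: near_eq_is_derive.
  have := nearU k; apply: filterS => h [h1 h2].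
  by rewrite /Z mul1r phase_coordsK //; have [[]] := hphi _ _ h1 h2.
rewrite /invariant_form /dm_dgamma !density_coords //; last by have [] := hphi _ _ hx hU.
(* The reordering sign in [dm_dgamma] is the same at both ends and is moved out. *)
have mulCA (s a b c' d : R) : a * b = c' * d -> a * (s * b) = c' * (s * d).
  by move=> e; rewrite mulrCA e mulrCA.
apply: mulCA.
have phi0x : phi 0 x = x.
  apply: phi0 => //; apply: (Uconv _ _ _ hx hU).
  by rewrite lexx /=; case: (leP 0 t) => // /ltW ->; rewrite orbT.
(* The normal row of the volume form is the radial solution of the linearized equation at the end
   points. *)
have rowE (y : phase) : phase_coords (0, y.2) = row_mx (lsubmx (phase_coords y)) 0.
  by rewrite /phase_coords row_mxKl linear0.
have wE : \matrix_k phase_coords (of_coords (w k)) = \matrix_k w k.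
  by apply/row_matrixP => k; rewrite !rowK of_coordsK.
have := volume_invariant expd Z0 hz Zsol Zu hw
  (fun s s01 => radial_solution hz s01) (fun s s01 => is_derive_density Js D0 Jc eps0 hz s01).
by rewrite mul1r mul0r phi0x !rowE wE.
Qed.

End Flow.

(** * Invariant measure and its explicit density *)

Theorem theorem5 (R : realType) (n : nat)
    (II : {linear 'M[R]_n.+1 -> 'M[R]_n.+1}) (D sigma rho eps : R)
    (hII : sym_posdef_on_so II) (hD : 0 < D)
    (hsigma : 0 < sigma) (hrho : 0 < rho)
    (heps : eps = sigma / (sigma + rho) \/
            (sigma != rho /\ eps = sigma / (sigma - rho))) :
  flow_preserves_form phase_space (rubber_rolling II D eps)
    (invariant_form II D eps)
  /\
  (forall a : 'I_n.+1 -> R,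
     (forall i, 0 < a i) ->
     (forall i j : 'I_n.+1, (i < j)%N ->
        II (wedge (basis_vec i) (basis_vec j)) =
        (a i * a j - D) *: wedge (basis_vec i) (basis_vec j)) ->
     exists2 c : R, 0 < c &
       forall g : 'cV[R]_n.+1, sphere n.+1 g ->
         density II D eps g =
         c * dotv g (diag_mx (\row_i a i) *m g)
               `^ (((2 * eps)^-1 - 1) * (n.+1%:R - 2))).
Proof.
have eps0 : eps != 0.
  have s0 : sigma != 0 by rewrite gt_eqF.
  case: heps => [->|[sr ->]]; rewrite mulf_neq0 ?invr_neq0 ?subr_eq0 //.
  by rewrite gt_eqF // addr_gt0.
split; first exact: rubber_rolling_invariant_form.
move=> a apos hdiag; exists ((\prod_i a i) `^ ((2 * eps)^-1 - 1)).
  by apply: powR_gt0; apply: prodr_gt0.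
by move=> g hg; exact: density_diag.
Qed.
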